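(* Let $\alpha>1$ be the constant of the power function $s\mapsto s^{\alpha}$. For the non-preemptive speed-scaling scheduling problem $P|any,V_j=V,\delta_j,energy|\sum C_j$ (moldable jobs on $m$ identical parallel processors, each job $j$ having the same total work $V$ and using any number of processors not exceeding $\delta_j$, minimizing the total completion time $\sum_j C_j$ under a given energy budget $E$), a $2$-approximate schedule can be found in polynomial time.
   Context: Model. A set of jobs $\mathcal{J}=\{1,\dots,n\}$ is to be scheduled non-preemptively on $m$ speed-scalable parallel processors, each of which processes at most one job at a time; $n$ and $m$ are part of the input. Each job $j$ is a moldable job: it is given with a total processing volume (work) $V_j$ and an integer upper bound $\delta_j$ with $1\le\delta_j\le m$; the scheduler chooses a number $m_j\in\{1,\dots,\delta_j\}$ of processors (fixed for the whole execution of the job), and the job is processed simultaneously on some $m_j$ processors. The work is divided uniformly among the processors used: each of the $m_j$ processors executes work $V_j/m_j$, and all of them run at the same speed while executing job $j$. Any positive real speed is available. A processor running at speed $s$ consumes energy at rate (power) $s^{\alpha}$, where $\alpha>1$ is a constant; thus if job $j$ is run on $m_j$ processors at constant speed with duration $t_j>0$, it consumes energy $m_j\,(V_j/m_j)^{\alpha}\,t_j^{1-\alpha}$. The scheduler chooses the numbers $m_j$, the speeds (durations), the processors and the start times. A schedule is feasible if the total energy consumption of all jobs is at most the given energy budget $E$. All jobs are available at time $0$; $C_j$ denotes the completion time of job $j$, and the goal is to minimize $\sum_{j\in\mathcal{J}} C_j$ over feasible schedules. In the problem of the claim, every instance satisfies $V_j=V$ for all $j$, for some common value $V>0$. A $\rho$-approximate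 schedule is a feasible schedule (in particular with energy consumption at most $E$) whose total completion time is at most $\rho$ times the minimum total completion time over all feasible schedules. *)

(* Defs.v *)
From HB Require Import structures.
From mathcomp Require Import all_boot all_order all_algebra.
From mathcomp Require Import all_classical all_reals exp.

Set Implicit Arguments.
Unset Strict Implicit.
Unset Printing Implicit Defensive.

Import Order.TTheory GRing.Theory Num.Theory.
Local Open Scope ring_scope.

Record instance (R : realType) := Instance {
  njobs : nat;
  nprocs : nat;
  work : 'I_njobs -> R;
  maxprocs : 'I_njobs -> nat;
  budget : R }.

Definition well_formed (R : realType) (I : instance R) : Prop :=
  [/\ (0 < nprocs I)%N,
      (forall j : 'I_(njobs I), 0 < work j),
      (forall j : 'I_(njobs I), (1 <= maxprocs j <= nprocs I)%N)
    & 0 < budget I].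

Definition equal_work (R : realType) (I : instance R) : Prop :=
  exists2 V : R, 0 < V & forall j : 'I_(njobs I), work j = V.

(* Speeds are encoded by durations: on k processors, job j of duration t runs
   at speed work j / (k * t). *)
Record schedule (R : realType) (I : instance R) := Schedule {
  procs : 'I_(njobs I) -> {set 'I_(nprocs I)};
  start : 'I_(njobs I) -> R;
  duration : 'I_(njobs I) -> R }.

Section Scheduling.
Context {R : realType} (alpha : R) {I : instance R}.
Implicit Type S : schedule I.

Definition completion S (j : 'I_(njobs I)) : R := start S j + duration S j.

Definition total_completion S : R := \sum_j completion S j.

Definition job_energy S (j : 'I_(njobs I)) : R :=
  let k : R := #|procs S j|%:R in
  k * (work j / k) `^ alpha * duration S j `^ (1 - alpha).

Definition energy S : R := \sum_j job_energy S j.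

Definition feasible S : Prop :=
  [/\ (forall j, (1 <= #|procs S j| <= maxprocs j)%N),
      (forall j, 0 <= start S j),
      (forall j, 0 < duration S j),
      (forall i j, i != j -> ~~ [disjoint procs S i & procs S j] ->
         completion S i <= start S j \/ completion S j <= start S i)
    & energy S <= budget I].

Definition optimum : R :=
  inf [set total_completion S | S in feasible]%classic.

Definition approximate (rho : R) S : Prop :=
  feasible S /\ total_completion S <= rho * optimum.

End Scheduling.

(* Model of computation. Optimal durations are irrational in general, so the
   algorithms run on a random access machine holding exact real numbers next to
   natural numbers, with finitely many unbounded arrays of each kind. Natural
   numbers serve as addresses and only support unit-cost addition, truncated
   subtraction, halving and comparison, so that their bit length stays
   polynomial in the running time and the input. Reals support the field
   operations, comparison and three powers with constant exponents: the power
   function s ^ alpha, its inverse, and the inverse of the energy per unit of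
   work s ^ (alpha - 1). There is no rounding from reals to naturals, and
   programs contain no real literal. *)

Inductive nexp :=
| NLit of nat
| NLoad of nat & nexp                   (* array, index *)
| NAdd of nexp & nexp
| NSub of nexp & nexp
| NHalf of nexp.

Inductive exponent := Alpha | InvAlpha | InvAlphaMinus1.

Inductive rexp :=
| ROfNat of nexp
| RLoad of nat & nexp                   (* array, index *)
| RAdd of rexp & rexp
| RSub of rexp & rexp
| RMul of rexp & rexp
| RDiv of rexp & rexp
| RPow of rexp & exponent.

Inductive bexp :=
| BNle of nexp & nexp
| BRle of rexp & rexp
| BNot of bexp
| BAnd of bexp & bexp.

Inductive cmd :=
| Skip
| NStore of nat & nexp & nexp           (* array, index, value *)
| RStore of nat & nexp & rexp           (* array, index, value *)
| Seq of cmd & cmd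
| If of bexp & cmd & cmd
| While of bexp & cmd.

Fixpoint ncost (e : nexp) : nat :=
  match e with
  | NLit _ => 1
  | NLoad _ e1 | NHalf e1 => (ncost e1).+1
  | NAdd e1 e2 | NSub e1 e2 => (ncost e1 + ncost e2).+1
  end.

Fixpoint rcost (e : rexp) : nat :=
  match e with
  | ROfNat e1 | RLoad _ e1 => (ncost e1).+1
  | RAdd e1 e2 | RSub e1 e2 | RMul e1 e2 | RDiv e1 e2 =>
      (rcost e1 + rcost e2).+1
  | RPow e1 _ => (rcost e1).+1
  end.

Fixpoint bcost (b : bexp) : nat :=
  match b with
  | BNle e1 e2 => (ncost e1 + ncost e2).+1
  | BRle e1 e2 => (rcost e1 + rcost e2).+1
  | BNot b1 => (bcost b1).+1
  | BAnd b1 b2 => (bcost b1 + bcost b2).+1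
  end.

Record state (R : realType) := State {
  nmem : nat -> nat -> nat;             (* array, index *)
  rmem : nat -> nat -> R }.

Definition update (T : Type) (f : nat -> nat -> T) (a i : nat) (v : T) :
    nat -> nat -> T :=
  fun b j => if (b == a) && (j == i) then v else f b j.

Section Semantics.
Context {R : realType} (alpha : R).
Implicit Type s : state R.

Fixpoint neval s (e : nexp) : nat :=
  match e with
  | NLit c => c
  | NLoad a e1 => nmem s a (neval s e1)
  | NAdd e1 e2 => (neval s e1 + neval s e2)%N
  | NSub e1 e2 => (neval s e1 - neval s e2)%N
  | NHalf e1 => (neval s e1)./2
  end.

Definition exponent_value (x : exponent) : R :=
  match x with
  | Alpha => alpha
  | InvAlpha => alpha^-1
  | InvAlphaMinus1 => (alpha - 1)^-1
  end.

Fixpoint reval s (e : rexp) : R :=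
  match e with
  | ROfNat e1 => (neval s e1)%:R
  | RLoad a e1 => rmem s a (neval s e1)
  | RAdd e1 e2 => reval s e1 + reval s e2
  | RSub e1 e2 => reval s e1 - reval s e2
  | RMul e1 e2 => reval s e1 * reval s e2
  | RDiv e1 e2 => reval s e1 / reval s e2
  | RPow e1 x => reval s e1 `^ exponent_value x
  end.

Fixpoint beval s (b : bexp) : bool :=
  match b with
  | BNle e1 e2 => (neval s e1 <= neval s e2)%N
  | BRle e1 e2 => reval s e1 <= reval s e2
  | BNot b1 => ~~ beval s b1
  | BAnd b1 b2 => beval s b1 && beval s b2
  end.

(* exec p s t s': p started in s halts in s' after t elementary steps. *)
Inductive exec : cmd -> state R -> nat -> state R -> Prop :=
| ExecSkip s : exec Skip s 1 s
| ExecNStore s a i e :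
    exec (NStore a i e) s (ncost i + ncost e).+1
      (State (update (nmem s) a (neval s i) (neval s e)) (rmem s))
| ExecRStore s a i e :
    exec (RStore a i e) s (ncost i + rcost e).+1
      (State (nmem s) (update (rmem s) a (neval s i) (reval s e)))
| ExecSeq p q s t s' u s'' :
    exec p s t s' -> exec q s' u s'' -> exec (Seq p q) s (t + u).+1 s''
| ExecIfTrue b p q s t s' :
    beval s b -> exec p s t s' -> exec (If b p q) s (bcost b + t).+1 s'
| ExecIfFalse b p q s t s' :
    ~~ beval s b -> exec q s t s' -> exec (If b p q) s (bcost b + t).+1 s'
| ExecWhileTrue b p s t s' u s'' :
    beval s b -> exec p s t s' -> exec (While b p) s' u s'' ->
    exec (While b p) s (bcost b + t + u).+1 s''
| ExecWhileFalse b p s :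
    ~~ beval s b -> exec (While b p) s (bcost b).+1 s.

End Semantics.

Section InputOutput.
Context {R : realType} (I : instance R).

Definition array_of (T : Type) (d : T) (f : 'I_(njobs I) -> T) (i : nat) : T :=
  oapp f d (insub i).

(* Naturals: array 0 is [n; m], array 1 holds the upper bounds.
   Reals: array 0 is [E], array 1 holds the works.
   All other cells are 0. *)
Definition input_state : state R :=
  State
    (fun a => match a with
              | 0%N => nth 0%N [:: njobs I; nprocs I]
              | 1%N => array_of 0%N (@maxprocs R I)
              | _ => fun=> 0%N
              end)
    (fun a => match a with
              | 0%N => nth 0 [:: budget I]
              | 1%N => array_of 0 (@work R I)
              | _ => fun=> 0
              end).

(* m is written in binary, so an output cannot list processors one by one in
   polynomial time; processor sets are unions of intervals of processors.
   Cell 0 of the natural array 2 is the number of intervals; the k-th one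
   consists of nmem s 5 k processors from processor nmem s 4 k on, and is
   allotted to job nmem s 3 k. Jobs and processors are numbered from 0.
   The real arrays 2 and 3 hold the start times and the durations. *)
Definition output_schedule (s : state R) : schedule I :=
  Schedule
    (fun j => finset (fun p : 'I_(nprocs I) =>
       [exists k : 'I_(nmem s 2 0),
          (nmem s 3 k == j) && (nmem s 4 k <= p < nmem s 4 k + nmem s 5 k)%N]))
    (fun j => rmem s 2 j)
    (fun j => rmem s 3 j).

Definition bit_length (k : nat) : nat := (trunc_log 2 k).+1.

(* Naturals count with their bit length, each of the n + 1 reals counts 1. *)
Definition input_size : nat :=
  (bit_length (njobs I) + bit_length (nprocs I)
   + \sum_(j < njobs I) bit_length (maxprocs j) + (njobs I).+1)%N.

End InputOutput.

(* Main.v *)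
(* Call the product of number of processors and duration the area of a job. With
   equal works, the energy of a job depends on its area a only, as V^alpha *
   a^(1 - alpha). For every schedule with areas a_j,
     2 * sum C_j >= sum a_j / delta_j + (1 / m) * sum_(i, j) min(a_i, a_j),
   because C_j is the midpoint of the execution plus half the duration, and the
   midpoints obey the mean busy time inequality on m processors. Permuting the
   areas among the jobs changes neither the energy nor the double sum, and the
   first sum is least when a and delta are sorted alike; then the bound is
   sum w_j a_j, where w_j depends only on delta_j and on the rank of j by delta.
   Its minimum under the energy budget is attained at a_j = c * w_j^(-1/alpha).
     Conversely, start the jobs first come, first served in the order of delta,
   job j on k_j = min(delta_j, ceil(m / 2)) processors with this area. While a
   job waits at least m / 2 processors are busy, so j starts before 2 / m times
   the area of its predecessors, and 1 / k_j <= 1 / m + 1 / delta_j bounds its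
   duration. Summing up, sum C_j <= sum w_j a_j <= 2 * optimum. *)
Require Import Defs.
From HB Require Import structures.
From mathcomp Require Import all_boot all_order all_algebra all_fingroup.
From mathcomp Require Import all_classical all_reals exp.
From mathcomp Require Import ring lra zify.

Set Implicit Arguments.
Unset Strict Implicit.
Unset Printing Implicit Defensive.

Import Order.TTheory GRing.Theory Num.Theory.
Local Open Scope ring_scope.

(** * Lower bound on the total completion time *)

Section LowerBound.
Context {R : realType}.

(** The second part is the mean busy time inequality on one processor: its right side is twice the
    integral of time over the intervals. Induct by removing the job that ends last; by the first
    part the others have total length at most its start time. *)
Lemma disjoint_intervals (J : finType) (S p : J -> R) (A : {set J}) :
  (forall j, 0 <= S j) -> (forall j, 0 < p j) ->
  {in A &, forall i j, i != j -> S i + p i <= S j \/ S j + p j <= S i} ->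
  (forall T, 0 <= T -> {in A, forall j, S j + p j <= T} ->
    \sum_(j in A) p j <= T) /\
  (\sum_(j in A) p j) ^+ 2 <= \sum_(j in A) p j * (2 * S j + p j).
Proof.
move=> S0 p0; have [k] := ubnP #|A|; elim: k A => // k IHk A leAk disj.
have [->|[i0 i0A]] := set_0Vmem A.
  by split=> [T T0 _|]; rewrite !big_set0 // expr0n.
pose l := [arg max_(i > i0 in A) (S i + p i)]%O.
have [lA lmax] : l \in A /\ {in A, forall i, S i + p i <= S l + p l}.
  by rewrite /l; case: arg_maxP => // i iA imax; split=> // j jA; exact: imax.
have before : {in A :\ l, forall i, S i + p i <= S l}.
  move=> i; rewrite in_setD1 => /andP[il iA].
  case: (disj i l iA lA il) => // Sl; have := lmax i iA; have := p0 i; lra.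
have [] := IHk (A :\ l).
- by move: leAk; rewrite (cardsD1 l A) lA; lia.
- by move=> i j; rewrite !in_setD1 => /andP[_ iA] /andP[_ jA]; exact: disj.
move=> /(_ (S l) (S0 l) before) sumS IHsq; split.
  by move=> T T0 AT; rewrite (big_setD1 l) //=; have := AT l lA; lra.
rewrite [X in X ^+ 2](big_setD1 l) //= [leRHS](big_setD1 l) //=.
move: sumS IHsq; set X := \sum_(j in A :\ l) p j => sumS IHsq.
have : p l * X <= p l * S l by rewrite ler_pM2l.
lra.
Qed.

(** Cauchy-Schwarz against the constant vector, from the nonnegativity of the sum of all squared
    differences. *)
Lemma sqr_sum_le (P : finType) (x : P -> R) :
  (\sum_i x i) ^+ 2 <= #|P|%:R * \sum_i x i ^+ 2.
Proof.
have : 0 <= \sum_i \sum_j (x i - x j) ^+ 2.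
  by apply: sumr_ge0 => i _; apply: sumr_ge0 => j _; exact: sqr_ge0.
have -> : \sum_i \sum_j (x i - x j) ^+ 2 =
    2 * (#|P|%:R * \sum_i x i ^+ 2) - 2 * (\sum_i x i) ^+ 2.
  transitivity (\sum_i (#|P|%:R * x i ^+ 2 - 2 * (x i * \sum_j x j)
      + \sum_j x j ^+ 2)).
    apply: eq_bigr => i _; rewrite mulr_sumr mulr_sumr.
    rewrite mulr_natl -sumr_const -sumrB -big_split /=.
    by apply: eq_bigr => j _; ring.
  rewrite big_split sumrB /= sumr_const -mulr_sumr -mulr_sumr -mulr_suml.
  by rewrite -mulr_natl; ring.
lra.
Qed.

(* Peels off the layer of height [min x] and drops a job attaining it. *)
Lemma layered_sum (J : finType) (a x Y : J -> R) (c : R) (A : {set J}) :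
  (forall j, 0 <= x j) ->
  (forall B : {set J}, c * (\sum_(j in B) a j) ^+ 2 <= \sum_(j in B) Y j) ->
  c * \sum_(i in A) \sum_(j in A) a i * a j * Num.min (x i) (x j)
    <= \sum_(j in A) x j * Y j.
Proof.
move=> x0 sqY; have [k] := ubnP #|A|; elim: k A x x0 => // k IHk A x x0 leAk.
have [->|[i0 i0A]] := set_0Vmem A; first by rewrite !big_set0 mulr0.
pose l := [arg min_(i < i0 in A) x i]%O.
have [lA lmin] : l \in A /\ {in A, forall i, x l <= x i}.
  by rewrite /l; case: arg_minP => // i iA imin; split=> // j jA; exact: imin.
(* Truncation at 0 keeps [y] nonnegative outside [A] too, as the induction hypothesis demands. *)
pose y i := Num.max 0 (x i - x l).
have yE i : i \in A -> y i = x i - x l.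
  by move=> iA; apply/max_idPr; rewrite subr_ge0 lmin.
have yl : y l = 0 by rewrite /y subrr maxxx.
have y0 i : 0 <= y i by rewrite /y le_max lexx.
have cardB : (#|A :\ l| < k)%N by move: leAk; rewrite (cardsD1 l A) lA; lia.
have := IHk (A :\ l) y y0 cardB.
have -> : \sum_(j in A :\ l) y j * Y j = \sum_(j in A) y j * Y j.
  by rewrite [RHS](big_setD1 l) //= yl mul0r add0r.
have -> : \sum_(i in A :\ l) \sum_(j in A :\ l) a i * a j * Num.min (y i) (y j)
   = \sum_(i in A) \sum_(j in A) a i * a j * Num.min (y i) (y j).
  rewrite [RHS](big_setD1 l) //= [X in _ = X + _]big1 ?add0r => [|j _]; last first.
    by rewrite yl min_l ?mulr0.
  apply: eq_bigr => i _; rewrite [RHS](big_setD1 l) //=.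
  by rewrite yl min_r ?mulr0 ?add0r.
have -> : \sum_(j in A) x j * Y j =
    x l * (\sum_(j in A) Y j) + \sum_(j in A) y j * Y j.
  rewrite mulr_sumr -big_split /=; apply: eq_bigr => j jA.
  by rewrite yE //; ring.
have -> : \sum_(i in A) \sum_(j in A) a i * a j * Num.min (x i) (x j) =
    x l * (\sum_(j in A) a j) ^+ 2 +
    \sum_(i in A) \sum_(j in A) a i * a j * Num.min (y i) (y j).
  rewrite expr2 mulr_suml mulr_sumr -big_split /=; apply: eq_bigr => i iA.
  rewrite !mulr_sumr -big_split /=; apply: eq_bigr => j jA.
  rewrite !yE // -[in LHS](subrK (x l) (x i)) -[in LHS](subrK (x l) (x j)).
  by rewrite -addr_minl; ring.
have := ler_wpM2l (x0 l) (sqY A); lra.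
Qed.

Definition area (I : instance R) (S : schedule I) j : R :=
  #|procs S j|%:R * duration S j.

(** A job contributes its duration to each of its processors. On one processor the jobs are disjoint
    in time, so [disjoint_intervals] applies; Cauchy-Schwarz over the processors produces the factor
    m. *)
Lemma area_sqr_le (alpha : R) (I : instance R) (S : schedule I)
    (A : {set 'I_(njobs I)}) :
  feasible alpha S ->
  (\sum_(j in A) area S j) ^+ 2 <=
    (nprocs I)%:R * \sum_(j in A) area S j * (2 * start S j + duration S j).
Proof.
case=> _ S0 d0 disj _.
have swap (F : 'I_(njobs I) -> R) : \sum_(j in A) #|procs S j|%:R * F j =
    \sum_p \sum_(j in A :&: [set j | p \in procs S j]) F j.
  under [RHS]eq_bigr => p _ do under eq_bigl => j do rewrite inE inE.
  rewrite (exchange_big_dep (fun j => j \in A)) /= => [|p j _ /andP[]//].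
  apply: eq_bigr => j jA; under eq_bigl => p do rewrite jA /=.
  by rewrite sumr_const mulr_natl.
rewrite /area swap; under [X in _ * X]eq_bigr do rewrite -mulrA.
rewrite swap; apply: le_trans (sqr_sum_le _) _; rewrite card_ord.
apply: ler_wpM2l => //; apply: ler_sum => p _.
apply: (proj2 (disjoint_intervals S0 d0 _)) => i j.
rewrite !inE => /andP[_ pi] /andP[_ pj] ij; apply: disj => //.
by apply/pred0Pn; exists p; rewrite /= pi pj.
Qed.

Lemma area_gt0 (alpha : R) (I : instance R) (S : schedule I) j :
  feasible alpha S -> 0 < area S j.
Proof.
by case=> card _ d0 _ _; rewrite mulr_gt0 // ltr0n; case/andP: (card j).
Qed.

Lemma total_completion_ge (alpha : R) (I : instance R) (S : schedule I) :
  well_formed I -> feasible alpha S ->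
  \sum_j area S j / (maxprocs j)%:R
    + (\sum_i \sum_j Num.min (area S i) (area S j)) / (nprocs I)%:R
    <= 2 * total_completion S.
Proof.
case=> m0 _ _ _ feasS; have a0 j := area_gt0 j feasS.
have [card _ d0 _ _] := feasS.
have m0R : 0 < (nprocs I)%:R :> R by rewrite ltr0n.
have -> : 2 * total_completion S =
    \sum_j duration S j + \sum_j (2 * start S j + duration S j).
  rewrite mulr_sumr -big_split /=; apply: eq_bigr => j _.
  by rewrite /completion; ring.
apply: lerD.
  apply: ler_sum => j _; have /andP[k1 kd] := card j.
  rewrite ler_pdivrMr ?ltr0n ?(leq_trans k1) // /area mulrC.
  by rewrite ler_wpM2l ?(ltW (d0 j)) // ler_nat.
(* Layers of height 1 / a_j cancel the areas on the right, and a_i a_j min(1 / a_i, 1 / a_j) =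
   min(a_i, a_j) on the left. *)
have := @layered_sum _ (area S) (fun j => (area S j)^-1)
  (fun j => area S j * (2 * start S j + duration S j)) (nprocs I)%:R^-1
  [set: 'I_(njobs I)]%SET.
have -> : \sum_(i in [set: 'I_(njobs I)]%SET)
    \sum_(j in [set: 'I_(njobs I)]%SET) area S i * area S j *
    Num.min (area S i)^-1 (area S j)^-1 =
    \sum_i \sum_j Num.min (area S i) (area S j).
  under eq_bigl => i do rewrite inE; apply: eq_bigr => i _.
  under eq_bigl => j do rewrite inE; apply: eq_bigr => j _.
  have [le|le] := leP (area S i) (area S j).
    by rewrite min_r ?lef_pV2 ?posrE // mulfK // gt_eqF.
  by rewrite min_l ?lef_pV2 ?posrE ?(ltW le) // mulrAC mulfV ?gt_eqF ?mul1r.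
have -> : \sum_(j in [set: 'I_(njobs I)]%SET)
   (area S j)^-1 * (area S j * (2 * start S j + duration S j)) =
   \sum_j (2 * start S j + duration S j).
  under eq_bigl => j do rewrite inE; apply: eq_bigr => j _.
  by rewrite mulKf ?gt_eqF.
rewrite mulrC; apply=> [j|B]; first by rewrite invr_ge0 ltW.
by rewrite ler_pdivrMl //; exact: area_sqr_le feasS.
Qed.

(* Among the rearrangements of b that minimise the sum of x_k b_(s k), one
   minimising a second objective with strictly decreasing coefficients is sorted. *)
Lemma rearrangement (n : nat) (pos : 'I_n -> 'I_n) (x b : 'I_n -> R) :
  injective pos -> (forall k l, (pos k < pos l)%N -> x l <= x k) ->
  exists s : {perm 'I_n},
    (forall k l, (pos k <= pos l)%N -> b (s k) <= b (s l)) /\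
    \sum_k x k * b (s k) <= \sum_k x k * b k.
Proof.
move=> inj_pos x_mono.
pose f (s : {perm 'I_n}) := \sum_k x k * b (s k).
pose g (s : {perm 'I_n}) := \sum_k (n - pos k)%:R * b (s k).
pose s := [arg min_(s < 1%g | f s <= f 1%g) g s]%O.
have [fs gs] : f s <= f 1%g /\ forall t, f t <= f 1%g -> g s <= g t.
  by rewrite /s; case: arg_minP.
exists s; split; last first.
  by apply: le_trans fs _; rewrite /f; under eq_bigr do rewrite perm1.
move=> k l; rewrite leq_eqVlt => /predU1P[/val_inj/inj_pos->//|kl].
rewrite leNgt; apply/negP => blk.
have kNl : k != l by apply: contraTneq kl => ->; rewrite ltnn.
have swap (y : 'I_n -> R) : \sum_i y i * b ((tperm k l * s)%g i) =
    \sum_i y i * b (s i) + (y k - y l) * (b (s l) - b (s k)).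
  rewrite (bigD1 k) //= (bigD1 l) 1?eq_sym //= [X in _ = X + _](bigD1 k) //=.
  rewrite [X in _ = _ + X + _](bigD1 l) 1?eq_sym //= !permM tpermL tpermR.
  rewrite (eq_bigr (fun i => y i * b (s i))); first by ring.
  by move=> i /andP[ik il]; rewrite permM tpermD // eq_sym.
have /gs : f (tperm k l * s)%g <= f 1%g.
  rewrite /f swap -/(f s); apply: le_trans fs; rewrite gerDl mulr_ge0_le0 ?subr_ge0 //.
    exact: x_mono.
  by rewrite subr_le0 ltW.
rewrite /g swap -/(g s) lerDl leNgt => /negP; apply.
rewrite nmulr_llt0 ?subr_lt0 // subr_gt0 ltr_nat.
by rewrite ltn_sub2l // (ltn_trans kl) // ltn_ord.
Qed.

End LowerBound.

(** * Areas of least weight under the energy budget *)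

Section Areas.
Context {R : realType}.

Lemma card_pos_geq (n : nat) (pos : 'I_n -> 'I_n) (v : nat) :
  injective pos -> #|[pred l | (v <= pos l)%N]| = (n - v)%N.
Proof.
move=> inj_pos; rewrite -sum1_card /=.
have := reindex_inj inj_pos (op := addn) (P := fun q : 'I_n => (v <= q)%N).
move=> /(_ 0%N (fun=> 1%N)) /= <-.
by rewrite -(big_geq_mkord v n xpredT (fun=> 1%N)) sum_nat_const_nat muln1.
Qed.

(** The minimum over an ordered pair is the value at the earlier position. So b_k is counted once
    for each l at or after k, and once more, with the roles exchanged, for each l strictly after
    k. *)
Lemma sum_min_sorted (n : nat) (pos : 'I_n -> 'I_n) (b : 'I_n -> R) :
  injective pos -> (forall k l, (pos k <= pos l)%N -> b k <= b l) ->
  \sum_k \sum_l Num.min (b k) (b l) =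
    \sum_k (2 * (n - (pos k).+1) + 1)%:R * b k.
Proof.
move=> inj_pos b_mono.
transitivity (\sum_k \sum_(l | (pos k <= pos l)%N) b k +
              \sum_k \sum_(l | (pos l < pos k)%N) b l).
  rewrite -big_split /=; apply: eq_bigr => k _.
  rewrite (bigID (fun l => (pos k <= pos l)%N)) /=; congr (_ + _).
    by apply: eq_bigr => l kl; rewrite min_l ?b_mono.
  apply: eq_big => [l|l]; rewrite -ltnNge // => lk.
  by rewrite min_r // b_mono // ltnW.
rewrite [X in _ + X](exchange_big_dep predT) //= -big_split /=.
apply: eq_bigr => k _; rewrite !sumr_const -mulrnDr mulr_natl.
have -> : #|(fun l => (pos k < pos l)%N)| = (n - (pos k).+1)%N.
  exact: card_pos_geq.
have -> : #|(fun l => (pos k <= pos l)%N)| = (n - pos k)%N.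
  exact: card_pos_geq.
by congr (_ *+ _); have := ltn_ord (pos k); lia.
Qed.

(** Bernoulli's inequality for a negative exponent: exp y >= 1 + y with y = (1 - alpha) ln r, then
    ln r <= r - 1, which the negative factor reverses. *)
Lemma powR_bernoulli (alpha r : R) : 1 < alpha -> 0 < r ->
  1 + (1 - alpha) * (r - 1) <= r `^ (1 - alpha).
Proof.
move=> alpha1 r0; rewrite /powR gt_eqF //.
apply: le_trans (expR_ge1Dx _); rewrite lerD2l.
apply: ler_wnM2l; first by lra.
have := @le_ln1Dx R (r - 1); (have -> : 1 + (r - 1) = r by ring); apply; lra.
Qed.

Lemma powR_1B (a x : R) : 0 < a -> a `^ (1 - x) = a * a `^ (- x).
Proof. by move=> a0; rewrite powRD ?(gt_eqF a0) ?implybT // powRr1 ?ltW. Qed.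

Section Optimal.
Variables (alpha V E : R) (n : nat) (w : 'I_n -> R).
Hypotheses (alpha1 : 1 < alpha) (V0 : 0 < V) (E0 : 0 < E).
Hypothesis w0 : forall j, 0 < w j.

(** The constant c for which the areas c w_j^(-1/alpha) exhaust the budget: they need energy V^alpha
    c^(1 - alpha) W. *)
Definition area_scale (W : R) : R := (V `^ alpha * W / E) `^ (alpha - 1)^-1.

(** The sum of the w_j^(1 - 1/alpha), written with the power 1/alpha that programs can compute. *)
Let W : R := \sum_j w j / w j `^ alpha^-1.

Definition optimal_area (j : 'I_n) : R := area_scale W / w j `^ alpha^-1.

(** The index j witnesses that n is positive; for n = 0 the sum is empty. *)
Let W0 (j : 'I_n) : 0 < W.
Proof.
rewrite /W (bigD1 j) //= ltr_pwDl ?divr_gt0 ?powR_gt0 //.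
by apply: sumr_ge0 => i _; rewrite divr_ge0 ?powR_ge0 ?ltW.
Qed.

Let c0 (j : 'I_n) : 0 < area_scale W.
Proof. by rewrite powR_gt0 // divr_gt0 // mulr_gt0 ?powR_gt0 ?(W0 j). Qed.

Lemma optimal_area_gt0 j : 0 < optimal_area j.
Proof. by rewrite divr_gt0 ?(c0 j) // powR_gt0. Qed.

(** The Lagrange condition: the derivative of the energy at the optimal areas is proportional to the
    weights. *)
Let optimal_area_powRN j :
  optimal_area j `^ (- alpha) = area_scale W `^ (- alpha) * w j.
Proof.
rewrite /optimal_area powRM ?(ltW (c0 j)) ?invr_ge0 ?powR_ge0 //.
congr (_ * _); rewrite -powRN -powRrM mulrNN mulVf ?powRr1 ?(ltW (w0 j)) //.
rewrite gt_eqF //. exact: lt_trans ltr01 alpha1.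
Qed.

Lemma optimal_area_energy : (0 < n)%N ->
  \sum_j V `^ alpha * optimal_area j `^ (1 - alpha) = E.
Proof.
move=> n0; pose j0 := Ordinal n0; have cc := c0 j0; have WW := W0 j0.
have X0 : 0 < V `^ alpha * W / E by rewrite divr_gt0 // mulr_gt0 ?powR_gt0.
rewrite (eq_bigr (fun j => V `^ alpha * area_scale W `^ (1 - alpha) *
  (w j / w j `^ alpha^-1))) => [|j _]; last first.
  rewrite !powR_1B ?optimal_area_gt0 //.
  by rewrite optimal_area_powRN /optimal_area; ring.
rewrite -mulr_sumr -/W /area_scale -powRrM.
have -> : (alpha - 1)^-1 * (1 - alpha) = -1.
  by rewrite -[1 - alpha]opprB mulrN mulVf // gt_eqF // subr_gt0.
rewrite powR_inv1 ?(ltW X0) // invf_div mulrAC mulrA mulrAC.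
by rewrite mulfV ?mul1r // gt_eqF // mulr_gt0 // powR_gt0.
Qed.

(** By convexity b_j^(1 - alpha) lies above its tangent at the optimal area, which is Bernoulli for
    the ratio b_j / a_j. By the Lagrange condition the tangents add up to the optimal energy plus a
    negative multiple of sum w_j (b_j - a_j). As b stays within the budget, that sum is
    nonnegative. *)
Lemma optimal_area_min (b : 'I_n -> R) : (forall j, 0 < b j) ->
  \sum_j V `^ alpha * b j `^ (1 - alpha) <= E ->
  \sum_j w j * optimal_area j <= \sum_j w j * b j.
Proof.
move=> b0 bE; have [n0|n0] := posnP n.
  by rewrite !big1 // => -[i lt_in]; exfalso; move: lt_in; rewrite n0.
have cc := c0 (Ordinal n0); have Va0 : 0 < V `^ alpha by rewrite powR_gt0.
have tangent j : optimal_area j `^ (1 - alpha) +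
    (1 - alpha) * area_scale W `^ (- alpha) * (w j * (b j - optimal_area j))
    <= b j `^ (1 - alpha).
  have a0 := optimal_area_gt0 j; have r0 := divr_gt0 (b0 j) a0.
  have a1 : optimal_area j `^ (1 - alpha) =
      area_scale W `^ (- alpha) * w j * optimal_area j.
    by rewrite powR_1B // optimal_area_powRN mulrC.
  rewrite -[X in _ <= X `^ _](divfK (lt0r_neq0 a0)).
  rewrite [X in _ <= X]powRM ?(ltW r0) ?(ltW a0) //.
  apply: le_trans (ler_wpM2r (powR_ge0 _ _) (powR_bernoulli alpha1 r0)).
  rewrite a1 le_eqVlt; apply/orP; left; apply/eqP.
  by field; rewrite gt_eqF.
move: bE; rewrite -[X in _ <= X](optimal_area_energy n0) -!mulr_sumr ler_pM2l //.
have /ler_sum : forall j, predT j -> optimal_area j `^ (1 - alpha) +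
    (1 - alpha) * area_scale W `^ (- alpha) * (w j * (b j - optimal_area j))
    <= b j `^ (1 - alpha) by [].
move=> /(_ (index_enum _)) /=; rewrite big_split /= -mulr_sumr => h1 h2.
have := le_trans h1 h2; rewrite gerDl nmulr_rle0; last first.
  by rewrite nmulr_rlt0 ?subr_lt0 // powR_gt0.
move=> le0; rewrite -subr_ge0 -sumrB; apply: le_trans le0 _.
by rewrite le_eqVlt; apply/orP; left; apply/eqP/eq_bigr => j _; rewrite mulrBr.
Qed.

End Optimal.

(** * The weights of the lower bound *)

Section Weights.
Variables (alpha : R) (I : instance R) (pos : 'I_(njobs I) -> 'I_(njobs I)).

Definition weight (j : 'I_(njobs I)) : R :=
  1 / (maxprocs j)%:R
    + (2 * (njobs I - (pos j).+1) + 1)%:R / (nprocs I)%:R.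

Hypotheses (alpha1 : 1 < alpha) (wfI : well_formed I) (inj_pos : injective pos).
Hypothesis pos_mono :
  forall i j, (pos i < pos j)%N -> (maxprocs i <= maxprocs j)%N.

Lemma weight_gt0 j : 0 < weight j.
Proof.
case: wfI => m0 _ dm _; have /andP[d0 _] := dm j.
by rewrite ltr_pwDl ?divr_ge0 // divr_gt0 // ltr0n.
Qed.

(** The factor k k^(-alpha) = k^(1 - alpha) merges with the power of the duration, leaving a power
    of the area. *)
Lemma job_energyE (V : R) (S : schedule I) j : 0 < V -> work j = V ->
  (0 < #|procs S j|)%N -> 0 < duration S j ->
  job_energy alpha S j = V `^ alpha * area S j `^ (1 - alpha).
Proof.
move=> V0 wV k0 d0; rewrite /job_energy /area wV.
have k0' : 0 < #|procs S j|%:R :> R by rewrite ltr0n.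
rewrite powRM ?(ltW V0) ?invr_ge0 ?(ltW k0') //.
rewrite powRM ?(ltW k0') ?(ltW d0) // (powR_1B _ k0').
rewrite -[#|procs S j|%:R^-1]powR_inv1 ?(ltW k0') //.
by rewrite -powRrM mulN1r; ring.
Qed.

Lemma optimal_area_le (V : R) (S : schedule I) :
  0 < V -> (forall j : 'I_(njobs I), work j = V) -> feasible alpha S ->
  \sum_j weight j * optimal_area alpha V (budget I) weight j
    <= 2 * total_completion S.
Proof.
move=> V0 wV feasS; have [m0 _ dm E0] := wfI.
apply: le_trans (total_completion_ge wfI feasS).
have [card _ d0 _ enS] := feasS; have a0 j := area_gt0 j feasS.
have [|s [s_mono s_le]] := @rearrangement R _ pos
    (fun j => (maxprocs j)%:R^-1) (area S) inj_pos.
  move=> k l kl; rewrite lef_pV2 ?posrE ?ltr0n ?ler_nat ?pos_mono //.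
    by case/andP: (dm l).
  by case/andP: (dm k).
have enE : energy alpha S = \sum_j V `^ alpha * area S j `^ (1 - alpha).
  apply: eq_bigr => j _; apply: job_energyE => //.
  by case/andP: (card j).
(* The permuted areas use the same energy, so they compete in [optimal_area_min]; being sorted along
   [pos], they turn the double sum into the second part of the weights. *)
apply: (@le_trans _ _ (\sum_j weight j * area S (s j))).
  apply: optimal_area_min => // [j|]; first exact: weight_gt0.
  by move: enS; rewrite enE (reindex_inj (@perm_inj _ s)).
have -> : \sum_i \sum_j Num.min (area S i) (area S j) =
    \sum_i \sum_j Num.min (area S (s i)) (area S (s j)).
  rewrite (reindex_inj (@perm_inj _ s)); apply: eq_bigr => i _.
  by rewrite (reindex_inj (@perm_inj _ s)).
rewrite (sum_min_sorted inj_pos s_mono) mulr_suml.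
under eq_bigr do rewrite /weight mulrDl.
rewrite big_split /= lerD //.
  under eq_bigr do rewrite mul1r.
  by under [leRHS]eq_bigr do rewrite mulrC.
by rewrite le_eqVlt; apply/orP; left; apply/eqP; apply: eq_bigr => i _; ring.
Qed.

End Weights.
End Areas.

(** * Programs with counting loops *)

Fixpoint nwrites (p : cmd) : seq nat :=
  match p with
  | NStore a _ _ => [:: a]
  | Seq p q | If _ p q => nwrites p ++ nwrites q
  | While _ p => nwrites p
  | _ => [::]
  end.

Fixpoint rwrites (p : cmd) : seq nat :=
  match p with
  | RStore a _ _ => [:: a]
  | Seq p q | If _ p q => rwrites p ++ rwrites q
  | While _ p => rwrites p
  | _ => [::]
  end.

Fixpoint loop_free (p : cmd) : bool :=
  match p with
  | Seq p q | If _ p q => loop_free p && loop_free q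
  | While _ _ => false
  | _ => true
  end.

Fixpoint max_cost (p : cmd) : nat :=
  match p with
  | Skip => 1
  | NStore _ i e => (ncost i + ncost e).+1
  | RStore _ i e => (ncost i + rcost e).+1
  | Seq p q => (max_cost p + max_cost q).+1
  | If b p q => (bcost b + (max_cost p + max_cost q)).+1
  | While b p => 2 * bcost b + max_cost p + 30
  end.

(* [max_cost] and [degree] describe the polynomial time bound of a program whose
   loops are all counting loops; loops get an amply large constant. *)
Fixpoint degree (p : cmd) : nat :=
  match p with
  | Seq p q | If _ p q => maxn (degree p) (degree q)
  | While _ p => (degree p).+1
  | _ => 0
  end.

Definition zero_cell (a : nat) : nexp := NLoad a (NLit 0).

(** The bound [e] is evaluated anew at every test, so the rules for loops ask that it keep its
    value. *)
Definition For (c : nat) (e : nexp) (p : cmd) : cmd :=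
  Seq (NStore c (NLit 0) (NLit 0))
    (While (BNot (BNle e (zero_cell c)))
      (Seq p (NStore c (NLit 0) (NAdd (zero_cell c) (NLit 1))))).

Section Logic.
Context {R : realType} (alpha : R).
Implicit Types (s : state R) (p : cmd) (Q : state R -> Prop).

(** A total correctness triple with time bound T. *)
Definition reaches p s T Q : Prop :=
  exists t s', [/\ exec alpha p s t s', (t <= T)%N & Q s'].

Definition unchanged (na ra : seq nat) s s' : Prop :=
  (forall a i, a \notin na -> nmem s' a i = nmem s a i) /\
  (forall a i, a \notin ra -> rmem s' a i = rmem s a i).

Lemma unchanged_trans na ra s1 s2 s3 :
  unchanged na ra s1 s2 -> unchanged na ra s2 s3 -> unchanged na ra s1 s3.
Proof.
move=> [n12 r12] [n23 r23]; split=> a i ai;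
  by rewrite (n23, r23) // (n12, r12).
Qed.

Lemma unchanged_sub na ra na' ra' s s' : all (mem na') na ->
  all (mem ra') ra -> unchanged na ra s s' -> unchanged na' ra' s s'.
Proof.
move=> /allP sn /allP sr [n r]; split=> a i ai; [apply: n | apply: r].
  by apply: contra ai; exact: sn.
by apply: contra ai; exact: sr.
Qed.

Lemma exec_unchanged p s t s' :
  exec alpha p s t s' -> unchanged (nwrites p) (rwrites p) s s'.
Proof.
elim=> {p s t s'} //=.
- by move=> s a i e; split=> // b k; rewrite inE => /negPf ba; rewrite /= /update ba.
- by move=> s a i e; split=> // b k; rewrite inE => /negPf ba; rewrite /= /update ba.
- move=> p q s t s' u s'' _ IHp _ IHq; apply: (@unchanged_trans _ _ _ s').
    by apply: unchanged_sub IHp; apply/allP => a; rewrite /= mem_cat => ->.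
  apply: unchanged_sub IHq; apply/allP => a; rewrite /= mem_cat => ->;
  by rewrite orbT.
- move=> b p q s t s' _ _; apply: unchanged_sub; apply/allP => a;
  by rewrite /= mem_cat => ->.
- move=> b p q s t s' _ _; apply: unchanged_sub; apply/allP => a;
  by rewrite /= mem_cat => ->; rewrite orbT.
- by move=> b p s t s' u s'' _ _ n12 _; exact: unchanged_trans.
Qed.

Lemma reaches_weaken p s T T' Q Q' :
  (T <= T')%N -> (forall s', Q s' -> Q' s') ->
  reaches p s T Q -> reaches p s T' Q'.
Proof.
move=> leT sub [t [s' [ex tT Qs']]]; exists t, s'.
by split=> //; [exact: leq_trans leT | exact: sub].
Qed.

Lemma reaches_seq p q s T T' Q' Q :
  reaches p s T Q' -> (forall s', Q' s' -> reaches q s' T' Q) ->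
  reaches (Seq p q) s (T + T').+1 Q.
Proof.
move=> [t [s' [ex tT Qs']]] /(_ s' Qs')[u [s'' [ex' uT Qs'']]].
by exists (t + u).+1, s''; split=> //; [exact: ExecSeq ex ex' | rewrite ltnS leq_add].
Qed.

(** Meaningful for loop-free programs; a loop gets the dummy result [s]. *)
Fixpoint run p s : state R :=
  match p with
  | NStore a i e => State (update (nmem s) a (neval s i) (neval s e)) (rmem s)
  | RStore a i e =>
      State (nmem s) (update (rmem s) a (neval s i) (reval alpha s e))
  | Seq p q => run q (run p s)
  | If b p q => if beval alpha s b then run p s else run q s
  | _ => s
  end.

Lemma reaches_run p s Q :
  loop_free p -> Q (run p s) -> reaches p s (max_cost p) Q.
Proof.
move=> lf Qs; suff [t [ex tT]] : exists t, exec alpha p s t (run p s) /\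
    (t <= max_cost p)%N by exists t, (run p s).
elim: p s lf {Qs} => [|a i e|a i e|p IHp q IHq|b p IHp q IHq|//] s /=.
- by exists 1%N; split=> //; exact: ExecSkip.
- by move=> _; eexists; split; first exact: ExecNStore.
- by move=> _; eexists; split; first exact: ExecRStore.
- move=> /andP[lp lq].
  have [t [ex tT]] := IHp s lp; have [u [ex' uT]] := IHq (run p s) lq.
  by exists (t + u).+1; split; [exact: ExecSeq ex ex' | rewrite ltnS leq_add].
- move=> /andP[lp lq].
  have [t [ex tT]] := IHp s lp; have [u [ex' uT]] := IHq s lq.
  have [bT|bF] := boolP (beval alpha s b).
    by eexists; split; [exact: ExecIfTrue bT ex | lia].
  by eexists; split; [exact: ExecIfFalse bF ex' | lia].
Qed.

Lemma run_unchanged p s :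
  loop_free p -> unchanged (nwrites p) (rwrites p) s (run p s).
Proof.
move=> lf; have [t [s' [ex _ def_s]]] := @reaches_run p s (eq (run p s)) lf erefl.
rewrite def_s; exact: exec_unchanged ex.
Qed.

Definition set_counter c v s : state R :=
  State (update (nmem s) c 0 v) (rmem s).

(** In round k the body may assume that the counter is k and that arrays the loop does not write are
    as at the start. The loop changes the counter between rounds, so the invariant must be
    insensitive to it. *)
Lemma reaches_for c e p N x C d (Inv : nat -> state R -> Prop) s :
  c \notin nwrites p -> (N <= x)%N -> (0 < x)%N ->
  (forall s', unchanged (c :: nwrites p) (rwrites p) s s' -> neval s' e = N) ->
  (forall k v s', Inv k s' -> Inv k (set_counter c v s')) ->
  Inv 0 s ->
  (forall k s', (k < N)%N -> unchanged (c :: nwrites p) (rwrites p) s s' ->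
     nmem s' c 0 = k -> Inv k s' -> reaches p s' (C * x ^ d) (Inv k.+1)) ->
  reaches (For c e p) s ((C + (2 * ncost e + 30)) * x ^ d.+1)
    (fun s' => Inv N s' /\ unchanged (c :: nwrites p) (rwrites p) s s').
Proof.
move=> cp Nx x0 eN Invc Inv0 step.
set T := (C * x ^ d)%N in step *.
rewrite /For; set W := While _ _.
(* Besides the body, a round costs [ncost e + 4] for the test, 6 for the increment and 2 for the
   sequence and the loop; the failing test ends the loop at cost [ncost e + 5]. *)
suff loop k s' : (k <= N)%N -> unchanged (c :: nwrites p) (rwrites p) s s' ->
    nmem s' c 0 = k -> Inv k s' ->
    reaches W s' ((N - k) * (T + ncost e + 12) + ncost e + 5)
      (fun s' => Inv N s' /\ unchanged (c :: nwrites p) (rwrites p) s s').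
  have : reaches (Seq (NStore c (NLit 0) (NLit 0)) W) s
      (3 + (N * (T + ncost e + 12) + ncost e + 5)).+1
      (fun s' => Inv N s' /\ unchanged (c :: nwrites p) (rwrites p) s s').
    apply: reaches_seq.
      exact: (@reaches_run (NStore c (NLit 0) (NLit 0)) _ (eq (set_counter c 0 s))).
    move=> _ <-; have := loop 0 (set_counter c 0 s); rewrite subn0; apply=> //.
    - split=> // a i; rewrite inE negb_or => /andP[/negPf ac _].
      by rewrite /= /update ac.
    - by rewrite /= /update !eqxx.
    - exact: Invc.
  apply: reaches_weaken => //; rewrite expnS /T.
  have : (0 < x ^ d)%N by rewrite expn_gt0 x0.
  set y := (x ^ d)%N => y0.
  have := leq_mul Nx (leqnn (C * y + ncost e + 12)).
  have xy : (x <= x * y)%N by rewrite leq_pmulr.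
  have := leq_mul xy (leqnn (ncost e + 12)).
  have : (ncost e + 9 <= (x * y) * (ncost e + 9))%N.
    by rewrite leq_pmull // muln_gt0 x0.
  rewrite !mulnDr !mulnDl; nia.
have [j] := ubnP (N - k); elim: j k s' => // j IHj k s' Nkj kN un ck Invk.
have [Nk|kN'] := leqP N k.
  have ->: k = N by apply/eqP; rewrite eqn_leq kN.
  rewrite subnn; exists (ncost e + 5)%N, s'; split=> //; last first.
    by split=> //; have -> : N = k by apply/eqP; rewrite eqn_leq kN Nk.
  have -> : (ncost e + 5)%N = (bcost (BNot (BNle e (zero_cell c)))).+1.
    by rewrite /=; lia.
  by apply: ExecWhileFalse => /=; rewrite negbK eN // ck.
have [t [s1 [ex tT Inv1]]] := step k s' kN' un ck Invk.
have un1 := exec_unchanged ex.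
have ck1 : nmem s1 c 0 = k by rewrite (proj1 un1).
pose s2 := set_counter c k.+1 s1.
have unc : unchanged (c :: nwrites p) (rwrites p) s s2.
  apply: unchanged_trans un _; apply: (@unchanged_trans _ _ _ s1).
    by apply: unchanged_sub un1; apply/allP => a; rewrite /= ?inE => ->; rewrite ?orbT.
  split=> // a i; rewrite inE negb_or => /andP[/negPf ac _].
  by rewrite /= /update ac.
have [] := IHj k.+1 s2 _ _ unc.
- by lia.
- by [].
- by rewrite /= /update !eqxx.
- exact: Invc.
move=> u [s3 [ex3 uT [Inv3 un3]]].
have exI : exec alpha (NStore c (NLit 0) (NAdd (zero_cell c) (NLit 1))) s1 6 s2.
  have := ExecNStore alpha s1 c (NLit 0) (NAdd (zero_cell c) (NLit 1)).
  by rewrite /= ck1 (addn1 k).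
have go : beval alpha s' (BNot (BNle e (zero_cell c))).
  by rewrite /= eN // ck -ltnNge.
have ex4 := ExecWhileTrue go (ExecSeq ex exI) ex3.
eexists; exists s3; split; [exact: ex4 | | by split].
rewrite /=; move: uT; rewrite -(subnSK kN'); lia.
Qed.

Section Halts.
Variable x : nat.
Hypothesis x0 : (0 < x)%N.

(** The time bound is read off the program text; x bounds the rounds of each loop and will be n +
    1. *)
Definition halts p s Q : Prop := reaches p s (max_cost p * x ^ degree p) Q.

Lemma halts_run p s Q : loop_free p -> Q (run p s) -> halts p s Q.
Proof.
move=> lf Qs; apply: reaches_weaken (reaches_run lf Qs) => //.
by rewrite leq_pmulr // expn_gt0 x0.
Qed.

Lemma halts_weaken p s Q Q' :
  (forall s', Q s' -> Q' s') -> halts p s Q -> halts p s Q'.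
Proof. by move=> sub; apply: reaches_weaken. Qed.

Lemma halts_seq p q s Q' Q :
  halts p s Q' -> (forall s', Q' s' -> halts q s' Q) -> halts (Seq p q) s Q.
Proof.
move=> hp hq; apply: reaches_weaken (reaches_seq hp hq) => //=.
have := leq_pexp2l x0 (leq_maxl (degree p) (degree q)).
have := leq_pexp2l x0 (leq_maxr (degree p) (degree q)).
have : (0 < x ^ maxn (degree p) (degree q))%N by rewrite expn_gt0 x0.
set y := (x ^ maxn _ _)%N => y0 hy hy'.
have := leq_mul (leqnn (max_cost p)) hy'.
have := leq_mul (leqnn (max_cost q)) hy; lia.
Qed.

Lemma halts_for c e p N (Inv : nat -> state R -> Prop) s :
  c \notin nwrites p -> (N <= x)%N ->
  (forall s', unchanged (c :: nwrites p) (rwrites p) s s' -> neval s' e = N) ->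
  (forall k v s', Inv k s' -> Inv k (set_counter c v s')) ->
  Inv 0 s ->
  (forall k s', (k < N)%N -> unchanged (c :: nwrites p) (rwrites p) s s' ->
     nmem s' c 0 = k -> Inv k s' -> halts p s' (Inv k.+1)) ->
  halts (For c e p) s
    (fun s' => Inv N s' /\ unchanged (c :: nwrites p) (rwrites p) s s').
Proof.
move=> cp Nx eN Invc Inv0 step.
apply: reaches_weaken (reaches_for cp Nx x0 eN Invc Inv0 step) => //=.
rewrite max0n maxn0 leq_mul2r; apply/orP; right; lia.
Qed.

End Halts.
End Logic.

(** * List scheduling *)

Section Rank.
Variables (n : nat) (d : 'I_n -> nat).

(* The truncated subtractions encode the lexicographic order on (d i, i). *)
Definition before (i j : 'I_n) : bool := (d i + (1 - (j - i)) <= d j)%N.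

Definition rank (j : 'I_n) : nat := (\sum_i before i j)%N.

Lemma rankE j : rank j = #|[set i | before i j]|.
Proof.
rewrite /rank -sum1_card [RHS]big_mkcond /=.
by apply: eq_bigr => i _; rewrite inE; case: before.
Qed.

(** By transitivity the predecessors of i are predecessors of j, and i itself is one only of j. *)
Lemma before_rank i j : before i j -> (rank i < rank j)%N.
Proof.
move=> ij; rewrite !rankE; apply/proper_card/properP; split.
  by apply/fintype.subsetP => k; rewrite !inE; move: ij; rewrite /before; lia.
by exists i; rewrite !inE ?ij // /before; lia.
Qed.

Lemma rank_lt j : (rank j < n)%N.
Proof.
rewrite rankE -[X in (_ < X)%N]card_ord -cardsT; apply/proper_card/properP.
by split; [exact: finset.subsetT | exists j; rewrite !inE // /before; lia].
Qed.

Lemma beforeVbefore i j : i != j -> before i j || before j i.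
Proof.
rewrite -(inj_eq val_inj) /before /=; case: (ltngtP i j) => // ij _; lia.
Qed.

Definition pos (j : 'I_n) : 'I_n := Ordinal (rank_lt j).

Lemma pos_inj : injective pos.
Proof.
move=> i j [eq_rank]; apply/eqP; apply: contraPT eq_rank.
by move=> /beforeVbefore /orP[]/before_rank; lia.
Qed.

Lemma pos_mono i j : (pos i < pos j)%N -> (d i <= d j)%N.
Proof.
rewrite /= => ij; have [ij'|] := eqVneq i j; first by rewrite ij'.
case/beforeVbefore/orP; first by rewrite /before; lia.
by move=> /before_rank; lia.
Qed.

End Rank.

(** For updates at the two indices k and r + 1, as when a segment is split. Moving terms across
    instead of subtracting serves the lengths in [nat] and the potential in [R] alike. *)
Lemma big_update2 (T : Type) (idx : T) (op : Monoid.com_law idx) (F F' : nat -> T)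
    (k r : nat) : (k <= r)%N ->
  (forall i, (i <= r)%N -> i != k -> F' i = F i) ->
  op (\big[op/idx]_(i < r.+2) F' i) (op (F k) (F r.+1)) =
  op (\big[op/idx]_(i < r.+2) F i) (op (F' k) (F' r.+1)).
Proof.
move=> kr eqF; rewrite [in LHS](big_ord_recr r.+1) [in RHS](big_ord_recr r.+1) /=.
rewrite (bigD1 (Ordinal (kr : (k < r.+1)%N))) //=.
rewrite [X in _ = op (op X _) _](bigD1 (Ordinal (kr : (k < r.+1)%N))) //=.
rewrite (eq_bigr (fun i : 'I_r.+1 => F i)) => [|i]; last first.
  by rewrite -(inj_eq val_inj) /= => ik; rewrite eqF // -ltnS.
set B := \big[_/_]_(_ < _ | _) _.
rewrite Monoid.mulmACA [RHS]Monoid.mulmACA; congr (op _ _); last first.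
  exact: Monoid.mulmC.
by rewrite Monoid.mulmAC [RHS]Monoid.mulmAC; congr (op _ _); exact: Monoid.mulmC.
Qed.

(* [m / 2 * T] plus the area committed after time [T] does not grow while time
   advances to [tau] with fewer than [k <= ceil(m / 2)] processors free. *)
Section Potential.
Context {R : realType}.
Variables (N m k : nat) (len : nat -> nat) (av : nat -> R).
Hypothesis sum_len : (\sum_(i < N) len i = m)%N.

Lemma potential_le (T tau A : R) :
  (k <= uphalf m)%N -> T <= tau -> (forall i, (i < N)%N -> T <= av i) ->
  (\sum_(i < N | (av i < tau)%R) len i < k)%N ->
  m%:R / 2 * T + \sum_(i < N) (len i)%:R * (av i - T) <= A ->
  m%:R / 2 * tau + \sum_(i < N) (len i)%:R * (Num.max (av i) tau - tau) <= A.
Proof.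
move=> km Ttau Tav ltk; apply: le_trans.
have le_term (i : 'I_N) : (len i)%:R * (Num.max (av i) tau - tau) +
    (~~ (av i < tau))%:R * (len i)%:R * (tau - T) <= (len i)%:R * (av i - T).
  have l0 : 0 <= (len i)%:R :> R by [].
  have := Tav i (ltn_ord i).
  have [lt|ge] := ltP (av i) tau => Ti /=.
    by rewrite subrr mulr0 !mul0r addr0 mulr_ge0 // subr_ge0.
  by rewrite mul1r -mulrDr ler_wpM2l //; lra.
(* Fewer than ceil(m / 2) processors become free before [tau], so the segments still busy have total
   length at least m / 2. *)
have : \sum_(i < N) (~~ (av i < tau))%:R * (len i)%:R * (tau - T) >=
    m%:R / 2 * (tau - T).
  rewrite -mulr_suml ler_wpM2r ?subr_ge0 //.
  have -> : \sum_(i < N) (~~ (av i < tau))%:R * (len i)%:R =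
      (\sum_(i < N | ~~ (av i < tau)%R) len i)%:R :> R.
    rewrite natr_sum [RHS]big_mkcond; apply: eq_bigr => i _.
    by case: (av i < tau); rewrite ?mul0r ?mul1r.
  rewrite ler_pdivrMr // -natrM ler_nat.
  move: sum_len; rewrite (bigID (fun i : 'I_N => av i < tau)) /=.
  move: km ltk (odd_double_half m); rewrite uphalf_half -muln2.
  set X := bigop _ _ _; set Y := bigop _ _ _; case: (odd m) => /=; lia.
have : \sum_(i < N) ((len i)%:R * (Num.max (av i) tau - tau) +
    (~~ (av i < tau))%:R * (len i)%:R * (tau - T)) <=
    \sum_(i < N) (len i)%:R * (av i - T) by apply: ler_sum.
rewrite big_split /=; lra.
Qed.

(** If k processors were free before [tau], the latest availability time below [tau] would be a
    smaller candidate. *)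
Lemma least_start (tau : R) : (0 < k)%N ->
  (forall i, (i < N)%N -> (k <= \sum_(i' < N | (av i' <= av i)%R) len i')%N ->
     tau <= av i) ->
  (\sum_(i < N | (av i < tau)%R) len i < k)%N.
Proof.
move=> k0 tau_min; rewrite ltnNge; apply/negP => lek.
case: (pickP (fun i : 'I_N => av i < tau)) => [i0 i0tau|none]; last first.
  by move: lek; rewrite big_pred0 // leqNgt k0.
pose l := [arg max_(i > i0 | av i < tau) av i]%O.
have [ltau lmax] : av l < tau /\ forall i : 'I_N, av i < tau -> av i <= av l.
  by rewrite /l; case: arg_maxP.
have := tau_min l (ltn_ord l); rewrite leNgt ltau => tau_le.
suff /tau_le : (k <= \sum_(i' < N | (av i' <= av l)%R) len i')%N by [].
apply: leq_trans lek _; rewrite [leqRHS]big_mkcond [leqLHS]big_mkcond.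
by apply: leq_sum => i _; case: ifP => // /lmax ->.
Qed.

End Potential.

Lemma card_interval (m x l : nat) : (x + l <= m)%N ->
  #|[set p : 'I_m | (x <= p < x + l)%N]| = l.
Proof.
move=> xlm; rewrite -sum1_card.
under eq_bigl => p do rewrite inE.
rewrite (big_ord_narrow_cond xlm (P := fun p => (x <= p)%N) (F := fun=> 1%N)) /=.
rewrite -(big_geq_mkord x (x + l) xpredT (fun=> 1%N)).
by rewrite sum_nat_const_nat muln1 addKn.
Qed.

(** * The list scheduling program *)

(* Segment i consists of the seglen_ i processors from segpos_ i on, all free from
   time avail_ i on. When the job of rank r is about to be placed there are r + 1
   segments; it splits at most one of them, the remainder becoming segment r + 1.
   Cell top_ bounds all availability times. *)
Local Notation "p ;; q" := (Seq p q) (at level 70, right associativity).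

(** Natural arrays 1 to 5 and real arrays 1 to 3 are fixed by the input and output conventions; the
    others are auxiliary. *)
Local Notation bound_ := 1%N (only parsing).
Local Notation count_ := 2%N (only parsing).
Local Notation outjob_ := 3%N (only parsing).
Local Notation outpos_ := 4%N (only parsing).
Local Notation outlen_ := 5%N (only parsing).
Local Notation rank_ := 6%N (only parsing).
Local Notation order_ := 7%N (only parsing).
Local Notation segpos_ := 8%N (only parsing).
Local Notation seglen_ := 9%N (only parsing).
Local Notation outer_ := 10%N (only parsing).
Local Notation middle_ := 11%N (only parsing).
Local Notation inner_ := 12%N (only parsing).
Local Notation need_ := 13%N (only parsing).
Local Notation acc_ := 14%N (only parsing).
Local Notation job_ := 15%N (only parsing).

Local Notation work_ := 1%N (only parsing).
Local Notation start_ := 2%N (only parsing).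
Local Notation dur_ := 3%N (only parsing).
Local Notation wsum_ := 4%N (only parsing).
Local Notation avail_ := 5%N (only parsing).
Local Notation top_ := 6%N (only parsing).
Local Notation tau_ := 7%N (only parsing).
Local Notation scale_ := 8%N (only parsing).

Local Notation var a := (zero_cell a) (only parsing).
Local Notation rvar a := (RLoad a (NLit 0)) (only parsing).
Local Notation njobs_exp := (NLoad 0 (NLit 0)) (only parsing).
Local Notation nprocs_exp := (NLoad 0 (NLit 1)) (only parsing).

(* Truth values are numbers: [1 - (x - y)] is 1 if [x <= y] and 0 otherwise. *)
Definition before_exp (i j : nexp) : nexp :=
  NSub (NLit 1) (NSub (NAdd (NLoad bound_ i) (NSub (NLit 1) (NSub j i)))
                      (NLoad bound_ j)).

Definition weight_exp (j : nexp) : rexp :=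
  let x := NSub njobs_exp (NAdd (NLoad rank_ j) (NLit 1)) in
  RAdd (RDiv (ROfNat (NLit 1)) (ROfNat (NLoad bound_ j)))
       (RDiv (ROfNat (NAdd (NAdd x x) (NLit 1))) (ROfNat nprocs_exp)).

Definition rank_step : cmd :=
  NStore rank_ (var outer_)
    (NAdd (NLoad rank_ (var outer_)) (before_exp (var middle_) (var outer_))).

Definition weigh_step : cmd :=
  RStore wsum_ (NLit 0)
    (RAdd (rvar wsum_)
          (RDiv (weight_exp (var outer_))
                (RPow (weight_exp (var outer_)) InvAlpha)));;
  NStore order_ (NLoad rank_ (var outer_)) (var outer_).

Definition rank_jobs : cmd :=
  For outer_ njobs_exp (For middle_ njobs_exp rank_step;; weigh_step).

Definition init_schedule : cmd :=
  RStore scale_ (NLit 0)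
    (RPow (RDiv (RMul (RPow (rvar work_) Alpha) (rvar wsum_)) (rvar 0))
          InvAlphaMinus1);;
  NStore seglen_ (NLit 0) nprocs_exp.

Local Notation fresh := (NAdd (var outer_) (NLit 1)) (only parsing).

(** With truncated subtraction x - (x - y) = min(x, y); here y = ceil(m / 2). *)
Definition procs_exp (j : nexp) : nexp :=
  NSub (NLoad bound_ j)
    (NSub (NLoad bound_ j) (NHalf (NAdd nprocs_exp (NLit 1)))).

(** By time [top_] all processors are free, so it is a valid first candidate for the start time. *)
Definition select_job : cmd :=
  NStore job_ (NLit 0) (NLoad order_ (var outer_));;
  NStore need_ (NLit 0) (procs_exp (var job_));;
  RStore dur_ (var job_)
    (RDiv (RDiv (rvar scale_) (RPow (weight_exp (var job_)) InvAlpha))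
          (ROfNat (var need_)));;
  RStore tau_ (NLit 0) (rvar top_).

Definition count_step : cmd :=
  If (BRle (RLoad avail_ (var inner_)) (RLoad avail_ (var middle_)))
    (NStore acc_ (NLit 0) (NAdd (var acc_) (NLoad seglen_ (var inner_))))
    Skip.

(* The start time is the least availability time by which enough processors are
   free; acc_ counts the processors free at the candidate time. *)
Definition find_start : cmd :=
  For middle_ fresh
    (NStore acc_ (NLit 0) (NLit 0);;
     For inner_ fresh count_step;;
     If (BAnd (BNle (var need_) (var acc_))
              (BRle (RLoad avail_ (var middle_)) (rvar tau_)))
       (RStore tau_ (NLit 0) (RLoad avail_ (var middle_)))
       Skip).

(** The job starts no later than the old [top_], so adding its duration keeps [top_] an upper
    bound. *)
Definition start_job : cmd :=
  RStore top_ (NLit 0) (RAdd (rvar top_) (RLoad dur_ (var job_)));;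
  RStore start_ (var job_) (rvar tau_);;
  NStore seglen_ fresh (NLit 0);;
  RStore avail_ fresh (rvar tau_).

Definition set_take : cmd :=
  NStore acc_ (NLit 0)
    (NSub (NLoad seglen_ (var middle_))
          (NSub (NLoad seglen_ (var middle_)) (var need_))).

Definition emit_interval : cmd :=
  NStore outjob_ (var count_) (var job_);;
  NStore outpos_ (var count_) (NLoad segpos_ (var middle_));;
  NStore outlen_ (var count_) (var acc_);;
  NStore count_ (NLit 0) (NAdd (var count_) (NLit 1)).

Definition split_segment : cmd :=
  NStore segpos_ fresh (NAdd (NLoad segpos_ (var middle_)) (var acc_));;
  NStore seglen_ fresh (NSub (NLoad seglen_ (var middle_)) (var acc_));;
  NStore seglen_ (var middle_) (var acc_).

Definition end_take : cmd :=
  RStore avail_ (var middle_) (RAdd (rvar tau_) (RLoad dur_ (var job_)));;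
  NStore need_ (NLit 0) (NSub (var need_) (var acc_)).

Definition take_segment : cmd :=
  set_take;; emit_interval;; split_segment;; end_take.

(** Free segments that the job does not need are raised to its start time. Hence no later job starts
    before it, as first come, first served and the potential argument require. *)
Definition take_step : cmd :=
  If (BRle (RLoad avail_ (var middle_)) (rvar tau_))
    (If (BNle (NLit 1) (var need_)) take_segment
       (RStore avail_ (var middle_) (rvar tau_)))
    Skip.

Definition schedule_jobs : cmd :=
  For outer_ njobs_exp
    (select_job;; find_start;; start_job;; For middle_ fresh take_step).

Definition list_scheduling : cmd :=
  rank_jobs;; init_schedule;; schedule_jobs.

Lemma big_lt_recr (T : Type) (idx : T) (op : Monoid.com_law idx) (n : nat)
    (r : 'I_n -> nat) (F : 'I_n -> T) (j : 'I_n) : injective r ->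
  \big[op/idx]_(i | (r i < (r j).+1)%N) F i =
  op (F j) (\big[op/idx]_(i | (r i < r j)%N) F i).
Proof.
move=> inj_r; rewrite (bigD1 j) //=; congr (op _ _); apply: eq_bigl => i.
by rewrite ltnS ltn_neqAle andbC (inj_eq inj_r).
Qed.

(** * Correctness of the program *)

Section Correctness.
Context {R : realType} (alpha : R) (I : instance R) (V : R).
Hypotheses (alpha1 : 1 < alpha) (wfI : well_formed I) (V0 : 0 < V).
Hypothesis workV : forall j : 'I_(njobs I), work j = V.

Local Notation n := (njobs I).
Local Notation m := (nprocs I).
Local Notation d := (@maxprocs R I).
Local Notation halts := (halts alpha n.+1).

Let rk : 'I_n -> nat := rank d.
Let w : 'I_n -> R := weight (pos d).
Let a : 'I_n -> R := optimal_area alpha V (budget I) w.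

Let rk_inj : injective rk.
Proof. by move=> i j ij; apply: (@pos_inj _ d); apply: val_inj. Qed.

Definition has_input (s : state R) : Prop :=
  [/\ nmem s 0 0 = n, nmem s 0 1 = m, forall j : 'I_n, nmem s 1 j = d j,
      rmem s 0 0 = budget I & forall j : 'I_n, rmem s 1 j = V].

Lemma has_input_unchanged na ra s s' : 0%N \notin na -> 1%N \notin na ->
  0%N \notin ra -> 1%N \notin ra -> unchanged na ra s s' ->
  has_input s -> has_input s'.
Proof.
move=> n0 n1 r0 r1 [nu ru] [h1 h2 h3 h4 h5].
by split=> [||j||j]; rewrite ?nu ?ru.
Qed.

Lemma has_input_input_state : has_input (input_state I).
Proof. by split=> //= j; rewrite /array_of valK //= workV. Qed.

Definition ranked (k : nat) (s : state R) : Prop :=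
  [/\ forall j : 'I_n, (j < k)%N -> nmem s rank_ j = rk j,
      forall j : 'I_n, (j < k)%N -> nmem s order_ (rk j) = j,
      forall i, (k <= i)%N -> nmem s rank_ i = 0%N
    & rmem s wsum_ 0 = \sum_(j : 'I_n | (j < k)%N) w j / w j `^ alpha^-1].

Lemma reval_weight s (j : 'I_n) e : has_input s -> neval s e = j ->
  nmem s rank_ j = rk j -> reval alpha s (weight_exp e) = w j.
Proof.
case=> h0 h1 hd _ _ ej hr; rewrite /= ej h0 h1 hd hr /w /weight /=.
by rewrite addnn -mul2n !addn1.
Qed.

Lemma rank_jobs_spec s : has_input s -> ranked 0 s ->
  halts rank_jobs s
    (fun s' => ranked n s' /\
       unchanged [:: outer_; middle_; rank_; order_] [:: wsum_] s s').
Proof.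
move=> inp rank0.
apply: halts_weaken (halts_for (Inv := ranked) (N := n) _ _ _ _ _ _ _) => //.
- by move=> s' [rs un]; split=> //; exact: unchanged_sub un.
- by move=> s' un; have [] := has_input_unchanged _ _ _ _ un inp.
- move=> k s1 kn un ck [rk_lt ord_lt rk_ge ws].
  have inp1 : has_input s1 by apply: has_input_unchanged un inp.
  have [h0 _ hd _ _] := inp1; pose j := Ordinal kn.
  apply: (@halts_seq _ _ _ _ _ _ _ (fun s2 => (nmem s2 rank_ k = rk j /\
      forall i, i != k -> nmem s2 rank_ i = nmem s1 rank_ i) /\
      unchanged [:: middle_; rank_] [::] s1 s2)) => //.
    pose Inv i (s2 : state R) := 
      nmem s2 rank_ k = (\sum_(l : 'I_n | (l < i)%N) before d l j)%N /\
      forall i, i != k -> nmem s2 rank_ i = nmem s1 rank_ i.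
    apply: halts_weaken (halts_for (Inv := Inv) (N := n) _ _ _ _ _ _ _) => //.
    + move=> s2 [[e1 e2] un2]; split=> //; split=> //; rewrite e1 /rk /rank.
      by apply: eq_bigl => i; rewrite ltn_ord.
    + by move=> s2 un2; have [] := has_input_unchanged _ _ _ _ un2 inp1.
    + by split=> //; rewrite rk_ge // big_pred0.
    + move=> i s2 lt_in un2 ci [e1 e2]; apply: halts_run => //.
      have [_ _ hd2 _ _] : has_input s2 by apply: has_input_unchanged un2 inp1.
      have ck2 : nmem s2 outer_ 0 = k by rewrite (proj1 un2).
      split=> [|i' ik]; rewrite /= /update /= ck2 ?eqxx.
        rewrite ci e1 (hd2 j) (hd2 (Ordinal lt_in)).
        rewrite (@big_lt_recr _ _ _ _ _ _ (Ordinal lt_in)); last exact: val_inj.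
        by rewrite addnC /before /=; congr (_ + _)%N; lia.
      by rewrite (negPf ik) e2.
  move=> s2 [[e1 e2] un2]; apply: halts_run => //.
  have inp2 : has_input s2 by apply: has_input_unchanged un2 inp1.
  have ck2 : nmem s2 outer_ 0 = k by rewrite (proj1 un2).
  have wj := @reval_weight s2 j (var outer_) inp2 ck2 e1.
  have o12 : nmem s2 order_ = nmem s1 order_.
    by apply/funext => i; rewrite (proj1 un2).
  have r12 : rmem s2 = rmem s1.
    by apply/funext => b; apply/funext => i; rewrite (proj2 un2).
  split.
  + move=> i; rewrite /= /update /= ltnS leq_eqVlt => /predU1P[ik|ik].
      by rewrite ik e1; congr rk; apply: val_inj.
    by rewrite e2 ?rk_lt // ltn_eqF.
  + move=> i; rewrite /= /update /= ck2 e1 ltnS leq_eqVlt.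
    have ij : (i : nat) = k -> i = j by move=> ik; apply: val_inj.
    (* Ranks are distinct, so the new entry of [order_] overwrites no earlier one. *)
    have [/rk_inj-> //|neq] := eqVneq (rk i) (rk j).
    move=> /predU1P[/ij ij'|ik]; first by rewrite ij' eqxx in neq.
    by rewrite o12 ord_lt.
  + move=> i ki; rewrite /= /update /= e2 ?rk_ge 1?ltnW //.
    by rewrite gtn_eqF.
  + transitivity (rmem s2 wsum_ 0 + reval alpha s2 (weight_exp (var outer_)) /
        reval alpha s2 (weight_exp (var outer_)) `^ alpha^-1); first by [].
    rewrite wj r12 ws.
    by rewrite (@big_lt_recr _ _ _ _ _ _ j) 1?addrC //; exact: val_inj.
Qed.

(** The program reads V from the work of job 0; the quantifier over j makes sure that there is
    one. *)
Lemma init_schedule_spec s : has_input s -> ranked n s ->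
  halts init_schedule s (fun s' =>
    [/\ forall j : 'I_n, rmem s' scale_ 0 =
          area_scale alpha V (budget I) (\sum_j w j / w j `^ alpha^-1),
        nmem s' seglen_ 0 = m &
       unchanged [:: seglen_] [:: scale_] s s']).
Proof.
move=> inp [_ _ _ ws]; apply: halts_run => //.
have [h0 h1 _ hE hV] := inp; split; last exact: (@run_unchanged _ alpha init_schedule).
  move=> j; have -> : \sum_j w j / w j `^ alpha^-1 = rmem s wsum_ 0.
    by rewrite ws; apply: eq_bigl => i; rewrite ltn_ord.
  have := hV (Ordinal (leq_ltn_trans (leq0n j) (ltn_ord j))) => /= V00.
  by rewrite /= /area_scale /update /= hE V00.
by rewrite /= /update.
Qed.

(** * Invariants of list scheduling *)

Definition cov (s : state R) (j p : nat) : bool :=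
  [exists k : 'I_(nmem s count_ 0),
     (nmem s outjob_ k == j) &&
     (nmem s outpos_ k <= p < nmem s outpos_ k + nmem s outlen_ k)%N].

Definition in_seg (s : state R) (i p : nat) : bool :=
  (nmem s segpos_ i <= p < nmem s segpos_ i + nmem s seglen_ i)%N.

Definition allotment (j : 'I_n) : nat := minn (d j) (uphalf m).

Definition run_time (j : 'I_n) : R := a j / (allotment j)%:R.

Definition finish (s : state R) (j : nat) : R := rmem s start_ j + rmem s dur_ j.

Definition prior_area (r : nat) : R := \sum_(j | (rk j < r)%N) a j.

(** Together the fields make the segments a partition of the m processors. *)
Record segments (N : nat) (s : state R) : Prop := Segments {
  seg_bound : forall i p, (i < N)%N -> in_seg s i p -> (p < m)%N;
  seg_disj : forall i i' p, (i < N)%N -> (i' < N)%N ->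
    in_seg s i p -> in_seg s i' p -> i = i';
  seg_sum : (\sum_(i < N) nmem s seglen_ i = m)%N }.

(** [cov_avail] preserves [cov_apart]: earlier jobs on a processor end by the time its segment is
    available, hence before a new job starts there. *)
Record placed (r N : nat) (s : state R) : Prop := Placed {
  cov_rank : forall (j : 'I_n) p, cov s j p -> (rk j < r)%N;
  cov_apart : forall (i j : 'I_n) p, i != j -> cov s i p -> cov s j p ->
    finish s i <= rmem s start_ j \/ finish s j <= rmem s start_ i;
  cov_avail : forall (j : 'I_n) i p, (i < N)%N -> cov s j p -> in_seg s i p ->
    finish s j <= rmem s avail_ i }.

Definition served (s : state R) (j : 'I_n) : Prop :=
  [/\ 0 <= rmem s start_ j, m%:R / 2 * rmem s start_ j <= prior_area (rk j),
      rmem s dur_ j = run_time j & #|[set p : 'I_m | cov s j p]%SET| = allotment j].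

(** The T of [sch_potential] is 0 initially and then the start of the last placed job. *)
Record scheduled (r : nat) (s : state R) : Prop := Scheduled {
  sch_seg : segments r.+1 s;
  sch_placed : placed r r.+1 s;
  sch_served : forall j, (rk j < r)%N -> served s j;
  sch_potential : exists T, [/\ 0 <= T,
    forall i, (i < r.+1)%N -> T <= rmem s avail_ i
    & m%:R / 2 * T + \sum_(i < r.+1) (nmem s seglen_ i)%:R *
        (rmem s avail_ i - T) <= prior_area r];
  sch_top : forall i, (i < r.+1)%N -> rmem s avail_ i <= rmem s top_ 0 }.

(* Job j, of rank r, starts at tau and is collecting its processors; segments
   below k have been visited, and need_ processors are still missing. *)
Record taking (r : nat) (j : 'I_n) (tau : R) (k : nat) (s : state R) : Prop :=
  Taking {
  tk_outer : nmem s outer_ 0 = r;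
  tk_job : nmem s job_ 0 = j;
  tk_tau : rmem s tau_ 0 = tau;
  tk_start : rmem s start_ j = tau;
  tk_dur : rmem s dur_ j = run_time j;
  tk_seg : segments r.+2 s;
  tk_placed : placed r.+1 r.+2 s;
  tk_served : forall i, (rk i < r)%N -> served s i;
  tk_fresh : (0 < nmem s need_ 0)%N -> nmem s seglen_ r.+1 = 0%N;
  tk_need : (nmem s need_ 0 <= \sum_(i < r.+1 |
    (k <= i)%N && (rmem s avail_ i <= tau)%R) nmem s seglen_ i)%N;
  tk_cov : (#|[set p : 'I_m | cov s j p]%SET| + nmem s need_ 0 = allotment j)%N;
  tk_avail : forall i, (i < k)%N || (i == r.+1) -> tau <= rmem s avail_ i;
  tk_fresh_avail : rmem s avail_ r.+1 = tau;
  tk_top : forall i, (i < r.+2)%N -> rmem s avail_ i <= rmem s top_ 0;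
  tk_top_job : tau + run_time j <= rmem s top_ 0;
  tk_potential : m%:R / 2 * tau + \sum_(i < r.+2) (nmem s seglen_ i)%:R *
      (Num.max (rmem s avail_ i) tau - tau)
    <= prior_area r + #|[set p : 'I_m | cov s j p]%SET|%:R * run_time j }.

Let d_gt0 (j : 'I_n) : (0 < d j)%N.
Proof. by case: wfI => _ _ /(_ j)/andP[]. Qed.

Let m_gt0 : (0 < m)%N.
Proof. by case: wfI. Qed.

Lemma allotment_gt0 j : (0 < allotment j)%N.
Proof. by rewrite /allotment leq_min d_gt0 uphalf_gt0 m_gt0. Qed.

Lemma a_gt0 j : 0 < a j.
Proof.
apply: optimal_area_gt0 => //; first by case: wfI.
by move=> i; apply: weight_gt0.
Qed.

Lemma run_time_gt0 j : 0 < run_time j.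
Proof. by rewrite divr_gt0 ?a_gt0 // ltr0n allotment_gt0. Qed.

Lemma rank_onto r : (r < n)%N -> exists j, rk j = r.
Proof.
move=> rn; exists (invF (@pos_inj _ d) (Ordinal rn)).
by have := f_invF (@pos_inj _ d) (Ordinal rn) => /(congr1 val).
Qed.

(** * Visiting one segment *)

Lemma covE s j p : cov s j p =
  \big[orb/false]_(k < nmem s count_ 0) ((nmem s outjob_ k == j) &&
     (nmem s outpos_ k <= p < nmem s outpos_ k + nmem s outlen_ k)%N).
Proof. by rewrite big_orE. Qed.

Lemma emit_interval_run s i p : cov (run alpha emit_interval s) i p =
  cov s i p || (i == nmem s job_ 0) &&
    (nmem s segpos_ (nmem s middle_ 0) <= p <
       nmem s segpos_ (nmem s middle_ 0) + nmem s acc_ 0)%N.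
Proof.
rewrite !covE; rewrite /= /update /= addn1 big_ord_recr /=.
rewrite eqxx eq_sym; congr (_ || _); apply: eq_bigr => q _.
by rewrite (ltn_eqF (ltn_ord q)).
Qed.

Lemma split_segment_run s r k (t := nmem s acc_ 0)
    (s' := run alpha split_segment s) :
  nmem s outer_ 0 = r -> nmem s middle_ 0 = k -> (k <= r)%N ->
  (forall i, nmem s' segpos_ i =
     if i == r.+1 then (nmem s segpos_ k + t)%N else nmem s segpos_ i) /\
  (forall i, nmem s' seglen_ i = if i == k then t else
     if i == r.+1 then (nmem s seglen_ k - t)%N else nmem s seglen_ i).
Proof.
move=> hr hk kr; rewrite /s' /t.
by split=> i; rewrite /= /update /= hr hk addn1.
Qed.

Lemma end_take_run s k (j : 'I_n) (s' := run alpha end_take s) :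
  nmem s middle_ 0 = k -> nmem s job_ 0 = j ->
  (forall i, rmem s' avail_ i =
     if i == k then rmem s tau_ 0 + rmem s dur_ j else rmem s avail_ i) /\
  nmem s' need_ 0 = (nmem s need_ 0 - nmem s acc_ 0)%N.
Proof. by move=> hk hj; split=> [i|]; rewrite /= /update /= ?hk ?hj. Qed.

Lemma eq_cov s s' i p : unchanged [:: acc_; need_; segpos_; seglen_] [:: avail_] s s' ->
  cov s' i p = cov s i p.
Proof.
move=> un; rewrite !covE (proj1 un) //; apply: eq_bigr => q _.
by rewrite !(proj1 un).
Qed.

Lemma take_segment_run s r k (j : 'I_n) (t := minn (nmem s seglen_ k) (nmem s need_ 0))
    (s' := run alpha take_segment s) :
  nmem s outer_ 0 = r -> nmem s middle_ 0 = k -> nmem s job_ 0 = j -> (k <= r)%N ->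
  [/\ forall i, nmem s' segpos_ i =
        if i == r.+1 then (nmem s segpos_ k + t)%N else nmem s segpos_ i,
      forall i, nmem s' seglen_ i = if i == k then t else
        if i == r.+1 then (nmem s seglen_ k - t)%N else nmem s seglen_ i,
      forall i p, cov s' i p = cov s i p || (i == j) &&
        (nmem s segpos_ k <= p < nmem s segpos_ k + t)%N,
      forall i, rmem s' avail_ i =
        if i == k then rmem s tau_ 0 + rmem s dur_ j else rmem s avail_ i
    & nmem s' need_ 0 = (nmem s need_ 0 - t)%N].
Proof.
move=> hr hk hj kr.
pose s1 := run alpha set_take s; pose s2 := run alpha emit_interval s1.
pose s3 := run alpha split_segment s2.
have -> : s' = run alpha end_take s3 by [].
have u1 : unchanged [:: acc_] [::] s s1 by exact: (run_unchanged _ (p := set_take)).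
have acc1 : nmem s1 acc_ 0 = t by rewrite /t minnE /= /update /= hk.
have u2 : unchanged [:: outjob_; outpos_; outlen_; count_] [::] s1 s2.
  exact: (run_unchanged _ (p := emit_interval)).
have cov2 i p : cov s2 i p = _ := emit_interval_run s1 i p.
have u3 : unchanged [:: segpos_; seglen_; seglen_] [::] s2 s3.
  exact: (run_unchanged _ (p := split_segment)).
have u4 : unchanged [:: need_] [:: avail_] s3 (run alpha end_take s3).
  exact: (run_unchanged _ (p := end_take)).
have [] := @split_segment_run s2 r k.
- by rewrite (proj1 u2) // (proj1 u1).
- by rewrite (proj1 u2) // (proj1 u1).
- by [].
have [] := @end_take_run s3 k j.
- by rewrite (proj1 u3) // (proj1 u2) // (proj1 u1).
- by rewrite (proj1 u3) // (proj1 u2) // (proj1 u1).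
rewrite -/s3; move: u1 u2 u3 u4 acc1 cov2; move: s1 s2 s3.
move=> s1 s2 s3 u1 u2 u3 u4 acc1 cov2.
move=> av4 need4 pos3 len3.
have acc2 : nmem s2 acc_ 0 = t by rewrite (proj1 u2).
have pos2 i : nmem s2 segpos_ i = nmem s segpos_ i.
  by rewrite (proj1 u2) // (proj1 u1).
have len2 i : nmem s2 seglen_ i = nmem s seglen_ i.
  by rewrite (proj1 u2) // (proj1 u1).
split.
- by move=> i; rewrite (proj1 u4) // pos3 acc2 !pos2.
- by move=> i; rewrite (proj1 u4) // len3 acc2 !len2.
- move=> i p; rewrite (eq_cov _ _ (unchanged_sub _ _ u4)) //.
  rewrite (eq_cov _ _ (unchanged_sub _ _ u3)) // cov2 acc1 !(proj1 u1) // hj hk.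
  by rewrite (eq_cov _ _ (unchanged_sub _ _ u1)).
- by move=> i; rewrite av4 !(proj2 u3) // !(proj2 u2) // !(proj2 u1).
- by rewrite need4 !(proj1 u3) // acc2 (proj1 u2) // (proj1 u1).
Qed.

Lemma served_ext (s s' : state R) (j : 'I_n) : (forall p, cov s' j p = cov s j p) ->
  rmem s' start_ j = rmem s start_ j -> rmem s' dur_ j = rmem s dur_ j ->
  served s j -> served s' j.
Proof.
move=> eqc es ed [h1 h2 h3 h4]; split; rewrite ?es ?ed // -h4.
by apply: eq_card => p; rewrite !inE eqc.
Qed.

Lemma taking_skip r j tau k s : (k < r.+1)%N -> tau < rmem s avail_ k ->
  taking r j tau k s -> taking r j tau k.+1 s.
Proof.
move=> kr tauk [] *; constructor=> //.
  rewrite (eq_bigl (fun i : 'I_r.+1 => (k <= i)%N && (rmem s avail_ i <= tau))) //.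
  move=> i; rewrite ltn_neqAle; have [ik|//] := eqVneq k i.
  by rewrite -ik leqnn leNgt tauk.
move=> i; rewrite ltnS leq_eqVlt -orbA => /predU1P[->|ik]; first exact: ltW.
by auto.
Qed.

(** The potential of [taking] uses the maximum of availability time and [tau], so raising a segment
    to [tau] changes no term of it. *)
Lemma taking_raise r j tau k s (s' := State (nmem s) (update (rmem s) avail_ k tau)) :
  (k < r.+1)%N -> rmem s avail_ k <= tau -> nmem s need_ 0 = 0%N ->
  taking r j tau k s -> taking r j tau k.+1 s'.
Proof.
move=> kr ktau need0 [] ho hj ht hs hd seg [prk papart pav] served fresh need covj.
move=> av fav top topj pot.
have av' i : rmem s' avail_ i = if i == k then tau else rmem s avail_ i by [].
have cov' i p : cov s' i p = cov s i p by [].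
have avle i : rmem s avail_ i <= rmem s' avail_ i.
  by rewrite av'; case: eqP => [->|].
have tau_top : tau <= rmem s top_ 0.
  by apply: le_trans topj; rewrite lerDl ltW ?run_time_gt0.
constructor=> //.
- by case: seg; constructor.
- by constructor=> // i i' p lti ci si; apply: le_trans (avle _); exact: (pav _ _ p).
- by rewrite [nmem _ _ _]need0.
- move=> i; rewrite ltnS leq_eqVlt -orbA av'; case: eqP => //= _; exact: av.
- by rewrite av' gtn_eqF.
- by move=> i ri; rewrite av'; case: eqP => // _; exact: top.
- apply: le_trans pot; rewrite lerD2l le_eqVlt; apply/orP; left; apply/eqP.
  apply: eq_bigr => i _; rewrite av'; case: eqP => // ->.
  by rewrite maxxx max_r.
Qed.

Lemma taking_take r (j : 'I_n) tau k s (s' := run alpha take_segment s) :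
  rk j = r -> (k < r.+1)%N -> nmem s middle_ 0 = k -> rmem s avail_ k <= tau ->
  (0 < nmem s need_ 0)%N -> taking r j tau k s -> taking r j tau k.+1 s'.
Proof.
move=> rkj kr hk ktau need0.
case=> ho hj ht hs hd [bound disj sum] [prk papart pav] srv fresh need covj.
move=> av fav top topj pot.
have un : unchanged (nwrites take_segment) (rwrites take_segment) s s'.
  exact: run_unchanged.
have {fresh} fresh := fresh need0.
have [] := take_segment_run ho hk hj kr; rewrite -/s'.
set t := minn _ _; set x := nmem s segpos_ k => pos' len' cov' av' need'.
clearbody s'.
have time0 := run_time_gt0 j.
have fink : finish s j = tau + run_time j by rewrite /finish hs hd.
have rNk : (r.+1 == k) = false by rewrite gtn_eqF.
have tlen : (t <= nmem s seglen_ k)%N by exact: geq_minl.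
have fin' i : finish s' i = finish s i by rewrite /finish !(proj2 un).
have new_in p : (x <= p < x + t)%N -> in_seg s k p.
  by rewrite /in_seg -/x; lia.
(* The segment before the split that contains segment i after it. *)
pose old i := if i == r.+1 then k else i.
have old_lt i : (i < r.+2)%N -> (old i < r.+2)%N.
  by rewrite /old; case: eqP => //; lia.
have in_old i p : in_seg s' i p -> in_seg s (old i) p.
  rewrite /in_seg /old pos' len'; have [->|ir] := eqVneq i r.+1.
    by rewrite rNk -/x; lia.
  by have [->|//] := eqVneq i k; rewrite -/x; lia.
have in_fresh p : in_seg s' r.+1 p -> (x + t <= p)%N.
  by rewrite /in_seg pos' eqxx => /andP[].
have in_k p : in_seg s' k p -> (x <= p < x + t)%N.
  by rewrite /in_seg pos' len' eqxx eq_sym rNk.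
(* Had job j taken p before, its finish, which exceeds [tau], would be at most the availability time
   of segment k, hence at most [tau]. *)
have new_cov p : (x <= p < x + t)%N -> ~~ cov s j p.
  move=> /new_in pk; apply/negP => cp; have := pav j k p (leqW kr) cp pk.
  by rewrite fink; lra.
have card' : #|[set p : 'I_m | cov s' j p]%SET| =
    (#|[set p : 'I_m | cov s j p]%SET| + t)%N.
  have cardt : #|[set p : 'I_m | (x <= p < x + t)%N]%SET| = t.
    have [->|t0] := posnP t.
      by apply: eq_card0 => p; rewrite inE addn0 ltnNge andbN.
    apply: card_interval; have := bound k (x + t).-1 (leqW kr).
    by rewrite /in_seg -/x; lia.
  rewrite -[in RHS]cardt -cardsUI.
  rewrite [X in (_ + X)%N]eq_card0 ?addn0 => [|p]; last first.
    by rewrite !inE; apply/negP => /andP[cp /new_cov]; rewrite cp.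
  by apply: eq_card => p; rewrite !inE cov' eqxx.
constructor.
- by rewrite (proj1 un).
- by rewrite (proj1 un).
- by rewrite (proj2 un).
- by rewrite (proj2 un).
- by rewrite (proj2 un).
- constructor.
  + by move=> i p /old_lt oi /in_old; exact: bound.
  + move=> i i' p lti lti' ii ii'.
    have := disj _ _ _ (old_lt _ lti) (old_lt _ lti')
      (in_old _ _ ii) (in_old _ _ ii').
    move: ii ii'; rewrite /old; have [->|_] := eqVneq i r.+1.
      have [->//|_] := eqVneq i' r.+1; move=> /in_fresh px + ki'.
      by rewrite -ki' => /in_k; lia.
    have [->|//] := eqVneq i' r.+1 => + /in_fresh px ik.
    by rewrite ik => /in_k; lia.
  + have := @big_update2 _ _ addn (nmem s seglen_) (nmem s' seglen_) k r kr.
    rewrite /= sum !len' eqxx rNk eqxx fresh => H.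
    have {H} := H _; rewrite addn0 subnKC // => H.
    apply/eqP; rewrite -(eqn_add2r (nmem s seglen_ k)) H //.
    by move=> i ir ik; rewrite len' (negPf ik) ltn_eqF.
- constructor.
  + move=> i p; rewrite cov' => /orP[/prk//|/andP[/eqP ij _]].
    by rewrite (val_inj ij) ltnS -rkj.
  + have new (i i' : 'I_n) p : i' != i -> (i == j :> nat) && (x <= p < x + t)%N ->
        cov s i' p -> finish s' i' <= rmem s' start_ i.
      move=> _ /andP[/eqP ij /new_in pk] ci'.
      rewrite fin' (proj2 un) // ij hs; apply: le_trans _ ktau.
      exact: (pav _ _ p (leqW kr)).
    move=> i i' p ii'; rewrite !cov' => /orP[ci|ni] /orP[ci'|ni'].
    * by rewrite !fin' !(proj2 un) //; exact: (papart _ _ p).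
    * by left; exact: (new _ _ p).
    * by right; apply: (new _ _ p) => //; rewrite eq_sym.
    * case/andP: ni => /eqP ij _; case/andP: ni' => /eqP i'j _.
      by case/eqP: ii'; apply: val_inj; rewrite /= ij i'j.
  + move=> i q p ltq; rewrite cov' fin' av' => /orP[ci|/andP[/eqP ij np]] iq.
      have := pav i (old q) p (old_lt _ ltq) ci (in_old _ _ iq).
      rewrite /old; have [->|_] := eqVneq q r.+1.
        by rewrite rNk fav => /le_trans; apply.
      by have [->|//] := eqVneq q k; rewrite ht hd; lra.
    have := disj _ _ _ (old_lt _ ltq) (leqW kr) (in_old _ _ iq) (new_in _ np).
    rewrite /old; have [qr|_ qk] := eqVneq q r.+1.
      by move: iq; rewrite qr => /in_fresh; lia.
    by rewrite qk eqxx ht hd ij fink.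
- move=> i ir; apply: served_ext (srv i ir); rewrite ?(proj2 un) // => p.
  rewrite cov' (_ : (i == j :> nat) = false) ?orbF //.
  by apply/eqP => /val_inj ij; move: ir; rewrite ij -rkj ltnn.
(* If processors are still missing, segment k was taken whole and its remainder is empty. *)
- rewrite need' len' rNk eqxx => H.
  by move: H tlen; rewrite /t; lia.
- rewrite need'.
  have -> : (\sum_(i < r.+1 | (k.+1 <= i)%N && (rmem s' avail_ i <= tau)%R)
      nmem s' seglen_ i = \sum_(i < r.+1 | ((k <= i)%N &&
        (rmem s avail_ i <= tau)%R) && (i != Ordinal kr)) nmem s seglen_ i)%N.
    apply: eq_big => [i|i /andP[ki _]].
      rewrite -(inj_eq val_inj) /= av' ltn_neqAle eq_sym.
      by have [->|_] := eqVneq (i : nat) k; rewrite ?andbF ?andbT.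
    by rewrite len' gtn_eqF // ltn_eqF.
  move: need; rewrite (bigD1 (Ordinal kr)) /= ?leqnn ?ktau //.
  move=> need_le; rewrite leq_subLR /t /minn.
  by case: ifP => _; [exact: need_le | exact: leq_addr].
- rewrite card' need' -covj /t.
  by have := geq_minr (nmem s seglen_ k) (nmem s need_ 0); lia.
- move=> i; rewrite ltnS leq_eqVlt -orbA av' ht hd.
  by case: eqP => [_ _|_ /av //]; lra.
- by rewrite av' rNk.
- move=> i ri; rewrite av' ht hd (proj2 un) //.
  by case: eqP => // _; exact: top.
- by rewrite (proj2 un).
(* The potential grows by t times the run time, exactly the area that job j gains on these t
   processors. *)
- pose F i : R := (nmem s seglen_ i)%:R * (Num.max (rmem s avail_ i) tau - tau).
  pose F' i : R := (nmem s' seglen_ i)%:R * (Num.max (rmem s' avail_ i) tau - tau).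
  have Fk : F k = 0 by rewrite /F max_r // subrr mulr0.
  have Fr : F r.+1 = 0 by rewrite /F fav maxxx subrr mulr0.
  have F'k : F' k = t%:R * run_time j.
    by rewrite /F' len' av' eqxx ht hd max_l; [congr (_ * _) | ]; lra.
  have F'r : F' r.+1 = 0 by rewrite /F' av' rNk fav maxxx subrr mulr0.
  have := @big_update2 _ _ +%R F F' k r kr.
  rewrite /= Fk Fr F'k F'r !addr0 => sumF'.
  rewrite [X in _ + X]sumF' => [|i ir ik]; last first.
    by rewrite /F /F' len' av' (negPf ik) ltn_eqF.
  by rewrite card' natrD mulrDl; move: pot; rewrite /F; lra.
Qed.

Lemma take_step_spec r j tau k s : rk j = r -> (k < r.+1)%N ->
  nmem s middle_ 0 = k -> taking r j tau k s ->
  taking r j tau k.+1 (run alpha take_step s).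
Proof.
move=> rkj kr hk tk; have ht := tk_tau tk.
have -> : run alpha take_step s = if rmem s avail_ k <= tau then
    (if (0 < nmem s need_ 0)%N then run alpha take_segment s
     else State (nmem s) (update (rmem s) avail_ k tau)) else s.
  by rewrite -hk -ht.
case: leP => [ktau|]; last by move=> ?; exact: taking_skip.
by case: posnP => need0; [exact: taking_raise | exact: taking_take].
Qed.

(** * Placing one job *)

Definition prepared (s : state R) : Prop :=
  [/\ has_input s, forall j : 'I_n, nmem s rank_ j = rk j,
      forall j : 'I_n, nmem s order_ (rk j) = j
    & forall j : 'I_n, rmem s scale_ 0 =
        area_scale alpha V (budget I) (\sum_j w j / w j `^ alpha^-1)].

Lemma prepared_unchanged na ra s s' :
  all [predC na] [:: 0; bound_; rank_; order_]%N ->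
  all [predC ra] [:: 0; work_; scale_]%N -> unchanged na ra s s' ->
  prepared s -> prepared s'.
Proof.
move=> /and5P[n0 n1 n2 n3 _] /and4P[r0 r1 r2 _] un [inp hr ho hs].
have [nu ru] := un; split.
- exact: has_input_unchanged un inp.
- by move=> j; rewrite nu.
- by move=> j; rewrite nu.
- by move=> j; rewrite ru // hs.
Qed.

Lemma select_job_run r (j : 'I_n) s (s' := run alpha select_job s) :
  prepared s -> nmem s outer_ 0 = r -> rk j = r ->
  [/\ nmem s' job_ 0 = j, nmem s' need_ 0 = allotment j,
      forall i, rmem s' dur_ i = if i == j then run_time j else rmem s dur_ i
    & rmem s' tau_ 0 = rmem s top_ 0].
Proof.
move=> prep ho rkj.
pose p1 := NStore job_ (NLit 0) (NLoad order_ (var outer_)).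
pose p2 := NStore need_ (NLit 0) (procs_exp (var job_)).
pose s1 := run alpha p1 s; pose s2 := run alpha p2 s1.
have prep1 : prepared s1 by apply: prepared_unchanged (run_unchanged alpha s (p := p1) _) _.
have un2 := run_unchanged alpha s1 (p := p2) erefl.
have prep2 : prepared s2 by apply: prepared_unchanged un2 _.
have job1 : nmem s1 job_ 0 = j.
  by case: prep => _ _ h _; rewrite /= /update /= ho -rkj h.
have job2 : nmem s2 job_ 0 = j by rewrite (proj1 un2).
have need2 : nmem s2 need_ 0 = allotment j.
  have [[_ hm hd _ _] _ _ _] := prep1; rewrite /s2.
  transitivity (nmem s1 bound_ (nmem s1 job_ 0) -
    (nmem s1 bound_ (nmem s1 job_ 0) - (nmem s1 0 1 + 1)./2))%N; first by [].
  by rewrite job1 hd hm addn1 /allotment minnE uphalfE.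
have [inp2 hr2 _ hs2] := prep2.
have wj := reval_weight inp2 (job2 : neval s2 (var job_) = j) (hr2 j).
have av i : rmem s2 avail_ i = rmem s avail_ i by [].
split=> //.
move=> i; transitivity (if i == nmem s2 job_ 0 then
  rmem s2 scale_ 0 / reval alpha s2 (weight_exp (var job_)) `^ alpha^-1 /
    (nmem s2 need_ 0)%:R else rmem s dur_ i); first by [].
by rewrite job2 need2 wj (hs2 j).
Qed.

Lemma find_start_spec r k T s :
  (r < n)%N -> nmem s outer_ 0 = r -> nmem s need_ 0 = k -> (k <= m)%N ->
  (\sum_(i < r.+1) nmem s seglen_ i = m)%N ->
  (forall i, (i < r.+1)%N -> T <= rmem s avail_ i) ->
  (forall i, (i < r.+1)%N -> rmem s avail_ i <= rmem s tau_ 0) ->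
  halts find_start s (fun s' =>
    [/\ T <= rmem s' tau_ 0 <= rmem s tau_ 0,
        (k <= \sum_(i < r.+1 | (rmem s avail_ i <= rmem s' tau_ 0)%R)
                nmem s seglen_ i)%N,
        forall i, (i < r.+1)%N ->
          (k <= \sum_(i' < r.+1 | (rmem s avail_ i' <= rmem s avail_ i)%R)
                nmem s seglen_ i')%N -> rmem s' tau_ 0 <= rmem s avail_ i
      & unchanged [:: middle_; acc_; inner_] [:: tau_] s s']).
Proof.
move=> rn ho hk km sum Tav avtau.
pose F x := (\sum_(i < r.+1 | (rmem s avail_ i <= x)%R) nmem s seglen_ i)%N.
pose Inv q (s' : state R) := [/\ T <= rmem s' tau_ 0 <= rmem s tau_ 0,
  (k <= F (rmem s' tau_ 0))%N & forall i, (i < q)%N -> (i < r.+1)%N ->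
    (k <= F (rmem s avail_ i))%N -> rmem s' tau_ 0 <= rmem s avail_ i].
apply: halts_weaken (halts_for (Inv := Inv) (N := r.+1) _ _ _ _ _ _ _) => //.
- move=> s' [[h1 h2 h3] un]; split=> //; last exact: unchanged_sub un.
  by move=> i ir; exact: h3.
- exact: leqW.
- by move=> s' un; rewrite /= (proj1 un) // ho addn1.
- split=> //.
    by rewrite lexx andbT; exact: le_trans (Tav 0%N isT) (avtau 0%N isT).
  by rewrite /F (eq_bigl xpredT) ?sum // => i; rewrite avtau.
move=> q s1 qr un1 hq [h1 h2 h3].
have ho1 : nmem s1 outer_ 0 = r by rewrite (proj1 un1).
have hk1 : nmem s1 need_ 0 = k by rewrite (proj1 un1).
have av1 i : rmem s1 avail_ i = rmem s avail_ i by rewrite (proj2 un1).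
have len1 i : nmem s1 seglen_ i = nmem s seglen_ i by rewrite (proj1 un1).
apply: (@halts_seq _ _ _ _ _ _ _ (eq (State (update (nmem s1) acc_ 0 0) (rmem s1)))) => //.
  exact: halts_run.
move=> _ <-; set s2 := State _ _.
have ho2 : nmem s2 outer_ 0 = r by [].
have hk2 : nmem s2 need_ 0 = k by [].
have hq2 : nmem s2 middle_ 0 = q by [].
have acc2 : nmem s2 acc_ 0 = 0%N by [].
have av2 i : rmem s2 avail_ i = rmem s avail_ i by exact: av1.
have len2 i : nmem s2 seglen_ i = nmem s seglen_ i by exact: len1.
have tau2 : rmem s2 tau_ 0 = rmem s1 tau_ 0 by [].
clearbody s2.
apply: (@halts_seq _ _ _ _ _ _ _ (fun s3 =>
    nmem s3 acc_ 0 = F (rmem s avail_ q) /\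
    unchanged [:: inner_; acc_] [::] s2 s3)) => //.
  pose Inv' e (s' : state R) := nmem s' acc_ 0 =
    (\sum_(i < r.+1 | (i < e)%N && (rmem s avail_ i <= rmem s avail_ q)%R)
       nmem s seglen_ i)%N.
  apply: halts_weaken (halts_for (Inv := Inv') (N := r.+1) _ _ _ _ _ _ _) => //.
  - move=> s' [h un]; split; last exact: unchanged_sub un.
    by rewrite h /F; apply: eq_bigl => i; rewrite ltn_ord.
  - exact: leqW.
  - by move=> s' un; rewrite /= (proj1 un) // ho2 addn1.
  - by rewrite /Inv' acc2 big_pred0.
  move=> e s3 er un3 he acc3; apply: halts_run => //.
  have av3 i : rmem s3 avail_ i = rmem s avail_ i by rewrite (proj2 un3).
  have len3 : nmem s3 seglen_ e = nmem s seglen_ e by rewrite (proj1 un3).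
  have hq3 : nmem s3 middle_ 0 = q by rewrite (proj1 un3).
  rewrite /Inv' /= he hq3 !av3.
  have -> : (\sum_(i < r.+1 | (i < e.+1)%N && (rmem s avail_ i <= rmem s avail_ q)%R)
      nmem s seglen_ i = (if (rmem s avail_ e <= rmem s avail_ q)%R
        then nmem s seglen_ e else 0) + nmem s3 acc_ 0)%N.
    rewrite acc3 big_mkcondr (@big_lt_recr _ _ _ _ _ _ (Ordinal er)) /=.
      by rewrite [in RHS]big_mkcondr.
    exact: val_inj.
  by case: ifP => _; rewrite ?add0n //= /update /= len3 addnC.
move=> s3 [acc3 un3]; apply: halts_run => //.
have av3 i : rmem s3 avail_ i = rmem s avail_ i by rewrite (proj2 un3).
have tau3 : rmem s3 tau_ 0 = rmem s1 tau_ 0 by rewrite (proj2 un3).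
have hq3 : nmem s3 middle_ 0 = q by rewrite (proj1 un3).
have hk3 : nmem s3 need_ 0 = k by rewrite (proj1 un3).
rewrite /= hk3 acc3 hq3 !av3 tau3.
have [/andP[kF qtau]|no] := ifPn.
  rewrite /Inv /= /update /=; split=> //.
  - by rewrite Tav //=; case/andP: h1 => _; exact: le_trans.
  - move=> i; rewrite ltnS leq_eqVlt => /predU1P[->//|iq] ir kFi.
    by apply: le_trans qtau _; exact: h3.
rewrite /Inv tau3; split=> // i; rewrite ltnS leq_eqVlt => /predU1P[->|]; last exact: h3.
by move=> _ kF; move: no; rewrite kF /= -ltNge => /ltW.
Qed.

Lemma start_job_run r (j : 'I_n) s (s' := run alpha start_job s) :
  nmem s outer_ 0 = r -> nmem s job_ 0 = j ->
  [/\ rmem s' top_ 0 = rmem s top_ 0 + rmem s dur_ j,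
      forall i, rmem s' start_ i = if i == j then rmem s tau_ 0 else rmem s start_ i,
      forall i, nmem s' seglen_ i = if i == r.+1 then 0%N else nmem s seglen_ i
    & forall i, rmem s' avail_ i =
        if i == r.+1 then rmem s tau_ 0 else rmem s avail_ i].
Proof.
by move=> ho hj; split=> [|i|i|i]; rewrite /= /update /= ?ho ?hj ?addn1.
Qed.

Lemma allotment_le j : (allotment j <= m)%N.
Proof.
by case: wfI => _ _ /(_ j)/andP[_ dm] _; apply: leq_trans dm; exact: geq_minl.
Qed.

Lemma prior_area_recr r j : rk j = r -> prior_area r.+1 = a j + prior_area r.
Proof. by move=> <-; apply: big_lt_recr; exact: rk_inj. Qed.

(** Fewer than [allotment j] processors are free before the least start [tau], so [potential_le]
    carries the potential from T to [tau]. Dropping the area committed after [tau] gives the bound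
    on the start time. *)
Lemma taking_start r (j : 'I_n) tau T s s' :
  rk j = r -> scheduled r s ->
  T <= tau <= rmem s top_ 0 ->
  (forall i, (i < r.+1)%N -> T <= rmem s avail_ i) ->
  m%:R / 2 * T + \sum_(i < r.+1) (nmem s seglen_ i)%:R * (rmem s avail_ i - T)
    <= prior_area r ->
  (allotment j <= \sum_(i < r.+1 | (rmem s avail_ i <= tau)%R) nmem s seglen_ i)%N ->
  (forall i, (i < r.+1)%N ->
     (allotment j <= \sum_(i' < r.+1 | (rmem s avail_ i' <= rmem s avail_ i)%R)
                nmem s seglen_ i')%N -> tau <= rmem s avail_ i) ->
  nmem s' outer_ 0 = r -> nmem s' job_ 0 = j -> nmem s' need_ 0 = allotment j ->
  rmem s' tau_ 0 = tau -> rmem s' top_ 0 = rmem s top_ 0 + run_time j ->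
  (forall i, rmem s' start_ i = if i == j then tau else rmem s start_ i) ->
  (forall i, rmem s' dur_ i = if i == j then run_time j else rmem s dur_ i) ->
  (forall i, nmem s' seglen_ i = if i == r.+1 then 0%N else nmem s seglen_ i) ->
  (forall i, rmem s' avail_ i = if i == r.+1 then tau else rmem s avail_ i) ->
  (forall i, nmem s' segpos_ i = nmem s segpos_ i) ->
  (forall i p, cov s' i p = cov s i p) ->
  m%:R / 2 * tau <= prior_area r /\ taking r j tau 0 s'.
Proof.
move=> rkj [[bound disj sum] [prk papart pav] srv _ top] /andP[Ttau tautop] Tav potT.
move=> free tau_min ho hj hk ht htop hs hd hlen hav hpos hcov.
have pot : m%:R / 2 * tau + \sum_(i < r.+1) (nmem s seglen_ i)%:R *
    (Num.max (rmem s avail_ i) tau - tau) <= prior_area r.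
  apply: (@potential_le _ _ _ (allotment j) _ _ sum T) => //; first exact: geq_minr.
  by apply: least_start => //; exact: allotment_gt0.
have pot0 : m%:R / 2 * tau <= prior_area r.
  apply: le_trans pot; rewrite lerDl; apply: sumr_ge0 => i _.
  by rewrite mulr_ge0 // subr_ge0 le_max lexx orbT.
split=> //.
have other (i : 'I_n) : (rk i < r)%N -> (i == j :> nat) = false.
  by move=> ir; apply/eqP => /val_inj ij; move: ir; rewrite ij rkj ltnn.
have fin' (i : 'I_n) : (rk i < r)%N -> finish s' i = finish s i.
  by move=> ir; rewrite /finish hs hd other.
have in_seg' i p : in_seg s' i p -> (i != r.+1) /\ in_seg s i p.
  by rewrite /in_seg hpos hlen; case: eqP => // _; lia.
have lt_r i : (i < r.+2)%N -> i != r.+1 -> (i < r.+1)%N.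
  by rewrite ltnS leq_eqVlt => /predU1P[->|//]; rewrite eqxx.
have len' (i : 'I_r.+1) : nmem s' seglen_ i = nmem s seglen_ i.
  by rewrite hlen ltn_eqF.
have av' (i : 'I_r.+1) : rmem s' avail_ i = rmem s avail_ i.
  by rewrite hav ltn_eqF.
have card0 : #|[set p : 'I_m | cov s' j p]%SET| = 0%N.
  apply: eq_card0 => p; rewrite inE hcov; apply/negbTE/negP => cp; have := prk j p cp.
  by rewrite rkj ltnn.
have len_r : nmem s' seglen_ r.+1 = 0%N by rewrite hlen eqxx.
constructor=> //.
- by rewrite hs eqxx.
- by rewrite hd eqxx.
- constructor.
  + by move=> i p ir /in_seg'[iN]; apply: bound; exact: lt_r.
  + move=> i i' p ir ir' /in_seg'[iN ii] /in_seg'[iN' ii'].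
    by apply: (disj _ _ p); rewrite ?lt_r.
  + by rewrite big_ord_recr /= len_r addn0 (eq_bigr _ (fun i _ => len' i)).
- constructor.
  + by move=> i p; rewrite hcov => ci; apply: leqW; exact: prk ci.
  + move=> i i' p ii'; rewrite !hcov => ci ci'.
    have ri := prk i p ci; have ri' := prk i' p ci'.
    rewrite (fin' i) // (fin' i') // !hs !other //; exact: (papart _ _ p).
  + move=> i q p qr; rewrite hcov => ci /in_seg'[qN qp].
    have ri := prk i p ci.
    by rewrite hav (negPf qN) fin' // (pav _ _ p) // lt_r.
- move=> i ir; apply: served_ext (srv i ir) => [p||]; first exact: hcov.
    by rewrite hs other.
  by rewrite hd other.
- rewrite hk; apply: leq_trans free _; rewrite leq_eqVlt; apply/orP; left; apply/eqP.
  by apply: eq_big => [i|i _]; rewrite ?av' ?len'.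
- by rewrite card0 hk.
- by move=> i /= /eqP->; rewrite hav eqxx.
- by rewrite hav eqxx.
- move=> i ir; rewrite hav htop; have time0 := run_time_gt0 j.
  by case: eqP => [_|/eqP iN]; [lra | have := top i (lt_r i ir iN); lra].
- by rewrite htop lerD2r.
- rewrite card0 mul0r addr0 big_ord_recr /= len_r mul0r addr0.
  apply: le_trans pot; rewrite lerD2l le_eqVlt; apply/orP; left; apply/eqP.
  by apply: eq_bigr => i _; rewrite len' av'.
Qed.

(** After all r + 1 segments the sum bounding [need_] is empty, so the allotment is complete, and
    allotment times run time is the area [a j] that turns [prior_area r] into [prior_area r.+1]. *)
Lemma taking_end r (j : 'I_n) tau s : rk j = r -> 0 <= tau ->
  m%:R / 2 * tau <= prior_area r -> taking r j tau r.+1 s -> scheduled r.+1 s.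
Proof.
move=> rkj tau0 pot0 [] ho hj ht hs hd seg pl srv fresh need covj av fav top topj pot.
have need0 : nmem s need_ 0 = 0%N.
  by move: need; rewrite big_pred0 => [|i]; [lia | rewrite leqNgt ltn_ord].
move: covj; rewrite need0 addn0 => covj.
have av_ge i : (i < r.+2)%N -> tau <= rmem s avail_ i.
  by rewrite ltnS leq_eqVlt orbC; exact: av.
constructor=> //.
- move=> i; rewrite ltnS leq_eqVlt => /predU1P[ri|]; last exact: srv.
  have -> : i = j by apply: rk_inj; rewrite rkj.
  by split; rewrite ?hs // rkj.
- exists tau; split=> //.
  rewrite (prior_area_recr rkj) [a j + _]addrC.
  apply: le_trans (_ : _ <= _) _; last apply: le_trans pot _.
  + rewrite lerD2l le_eqVlt; apply/orP; left; apply/eqP.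
    by apply: eq_bigr => i _; rewrite max_l // av_ge.
  rewrite covj lerD2l /run_time mulrC divfK //.
  by rewrite pnatr_eq0 -lt0n allotment_gt0.
Qed.

Lemma schedule_jobs_spec s : prepared s -> scheduled 0 s ->
  halts schedule_jobs s (scheduled n).
Proof.
move=> prep sch0.
apply: halts_weaken (halts_for (Inv := scheduled) (N := n) _ _ _ _ _ _ _) => //.
- by move=> s' [].
- move=> s' un; have : prepared s' by apply: prepared_unchanged un prep.
  by case=> [[]].
- by move=> k v s' [[? ? ?] [? ? ?] ? ? ?]; constructor.
move=> r s0 rn un0 ho sch.
have prep0 : prepared s0 by apply: prepared_unchanged un0 prep.
have [j rkj] := rank_onto rn.
have [_ _ _ [T [T0 Tav potT]] top] := sch; have [_ _ sum] := sch_seg sch.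
pose s1 := run alpha select_job s0.
apply: (@halts_seq _ _ _ _ _ _ _ (eq s1)) => //; first exact: halts_run.
move=> _ <-.
have [job1 need1 dur1 tau1] := select_job_run prep0 ho rkj.
have un1 : unchanged (nwrites select_job) (rwrites select_job) s0 s1.
  exact: run_unchanged.
rewrite -/s1 in job1 need1 dur1 tau1; clearbody s1.
have ho1 : nmem s1 outer_ 0 = r by rewrite (proj1 un1).
have av1 i : rmem s1 avail_ i = rmem s0 avail_ i by rewrite (proj2 un1).
have len1 i : nmem s1 seglen_ i = nmem s0 seglen_ i by rewrite (proj1 un1).
apply: halts_seq => //.
  apply: (@find_start_spec r (allotment j) T s1) => //.
  - exact: allotment_le.
  - by rewrite -[RHS]sum; apply: eq_bigr => i _.
  - by move=> i ir; rewrite av1 Tav.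
  - by move=> i ir; rewrite av1 tau1 top.
move=> s2 [tau2 free2 min2 un2]; set tau := rmem s2 tau_ 0 in tau2 free2 min2.
have ho2 : nmem s2 outer_ 0 = r by rewrite (proj1 un2).
have job2 : nmem s2 job_ 0 = j by rewrite (proj1 un2).
pose s3 := run alpha start_job s2.
apply: (@halts_seq _ _ _ _ _ _ _ (eq s3)) => //; first exact: halts_run.
move=> _ <-.
have [top3 start3 len3 av3] := start_job_run ho2 job2.
have un3 : unchanged (nwrites start_job) (rwrites start_job) s2 s3.
  exact: run_unchanged.
rewrite -/s3 in top3 start3 len3 av3; clearbody s3.
have := @taking_start r j tau T s0 s3 rkj sch.
case.
- by rewrite -tau1.
- by [].
- by [].
- apply: leq_trans free2 _; rewrite leq_eqVlt; apply/orP; left; apply/eqP.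
  by apply: eq_big => [i|i _]; rewrite ?av1 ?len1.
- move=> i ir H; rewrite -av1; apply: min2 => //; apply: leq_trans H _.
  rewrite leq_eqVlt; apply/orP; left; apply/eqP.
  by apply: eq_big => [i'|i' _]; rewrite ?av1 ?len1.
- by rewrite (proj1 un3).
- by rewrite (proj1 un3).
- by rewrite (proj1 un3) // (proj1 un2).
- by rewrite (proj2 un3).
- rewrite top3 (proj2 un2) // (proj2 un1) // (proj2 un2) // dur1 eqxx //.
- by move=> i; rewrite start3; case: eqP => // _; rewrite (proj2 un2) // (proj2 un1).
- by move=> i; rewrite (proj2 un3) // (proj2 un2).
- by move=> i; rewrite len3 (proj1 un2) // len1.
- by move=> i; rewrite av3; case: eqP => // _; rewrite (proj2 un2) // av1.
- by move=> i; rewrite (proj1 un3) // (proj1 un2) // (proj1 un1).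
- move=> i p; rewrite !covE (proj1 un3) // (proj1 un2) // (proj1 un1) //.
  by apply: eq_bigr => q _; rewrite !(proj1 un3) // !(proj1 un2) // !(proj1 un1).
move=> pot0 tk0.
have ho3 := tk_outer tk0.
apply: halts_weaken (halts_for (Inv := taking r j tau) (N := r.+1) _ _ _ _ _ _ _) => //.
- move=> s4 [tk4 _]; apply: taking_end tk4 => //.
  by case/andP: tau2 => Ttau _; exact: le_trans Ttau.
- exact: leqW.
- by move=> s' un; rewrite /= (proj1 un) // ho3 addn1.
- move=> k v s' [? ? ? ? ? [? ? ?] [? ? ?] ? ? ? ? ? ? ? ? ?].
  by constructor.
move=> k s4 kr un4 hk tk4; apply: halts_run => //.
exact: take_step_spec.
Qed.

Lemma list_scheduling_spec :
  halts list_scheduling (input_state I) (scheduled n).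
Proof.
have inp0 := has_input_input_state.
have rank0 : ranked 0 (input_state I).
  by split=> //; rewrite big_pred0.
apply: halts_seq => //; first exact: (rank_jobs_spec inp0 rank0).
move=> s1 [rk1 un1].
have inp1 : has_input s1 by apply: has_input_unchanged un1 inp0.
apply: halts_seq => //; first exact: (init_schedule_spec inp1 rk1).
move=> s2 [scale2 len2 un2]; apply: schedule_jobs_spec => //.
  have inp2 : has_input s2 by apply: has_input_unchanged un2 inp1.
  have [rk_eq ord_eq _ _] := rk1.
  by split=> // j; rewrite (proj1 un2) // ?rk_eq ?ord_eq.
have av i : rmem s2 avail_ i = 0 by rewrite (proj2 un2) // (proj2 un1).
have no_cov i p : cov s2 i p = false.
  rewrite covE (proj1 un2) // (proj1 un1) //= big_ord0 //.
constructor=> //.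
- have segpos0 : nmem s2 segpos_ 0 = 0%N by rewrite (proj1 un2) // (proj1 un1).
  constructor.
  + by move=> i p; rewrite ltnS leqn0 => /eqP->; rewrite /in_seg segpos0 len2.
  + by move=> i i' p; rewrite !ltnS !leqn0 => /eqP-> /eqP->.
  + by rewrite big_ord_recr big_ord0 /= len2.
- by constructor=> [j p|i j p _|j i p _]; rewrite no_cov.
- exists 0; split=> // [i _|]; first by rewrite av.
  rewrite mulr0 add0r big_ord_recr big_ord0 /= av subrr mulr0 addr0.
  by apply: sumr_ge0 => i _; exact/ltW/a_gt0.
- by move=> i _; rewrite av (proj2 un2) // (proj2 un1).
Qed.

(** * Feasibility and approximation ratio *)

Lemma invr_allotment_le j : (allotment j)%:R^-1 <= m%:R^-1 + (d j)%:R^-1 :> R.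
Proof.
have [m0 _ /(_ j)/andP[d0 dm] _] := wfI.
have mi : 0 < m%:R^-1 :> R by rewrite invr_gt0 ltr0n.
rewrite /allotment; case: leqP => [_|_]; first by rewrite lerDr ltW.
(* Here the allotment is ceil(m / 2), whose inverse is at most 2 / m, and the bound of job j is at
   most m. *)
apply: (@le_trans _ _ (m%:R^-1 + m%:R^-1)); last first.
  by rewrite lerD2l lef_pV2 ?posrE ?ltr0n ?ler_nat.
have -> : m%:R^-1 + m%:R^-1 = 2 / m%:R :> R by rewrite mulr_natl mulr2n.
rewrite ler_pdivlMr ?ltr0n //.
rewrite ler_pdivrMl ?ltr0n ?uphalf_gt0 // -natrM ler_nat muln2.
rewrite -{1}(odd_double_half m) uphalf_half doubleD leq_add2r.
by case: (odd m).
Qed.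

Lemma scheduled_feasible s : scheduled n s ->
  feasible alpha (output_schedule I s).
Proof.
case=> _ [_ apart _] srv _ _.
have {}srv j : served s j by apply: srv; exact: rank_lt.
have card j : #|procs (output_schedule I s) j| = allotment j by case: (srv j).
have allotmentR j : (allotment j)%:R != 0 :> R by rewrite pnatr_eq0 -lt0n allotment_gt0.
have [_ _ _ E0] := wfI.
split.
- by move=> j; rewrite card allotment_gt0 geq_minl.
- by move=> j; case: (srv j).
- by move=> j; have [_ _ dur _] := srv j; rewrite /= dur run_time_gt0.
- move=> i j ij /pred0Pn[p /andP[]]; rewrite /= !inE => pi pj.
  exact: (apart i j p).
(* The allotment cancels in the area, leaving the optimal area; the budget is then met exactly
   unless there is no job. *)
- have -> : energy alpha (output_schedule I s) =
      \sum_j V `^ alpha * a j `^ (1 - alpha).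
    apply: eq_bigr => j _; have [_ _ dur _] := srv j.
    rewrite (job_energyE _ V0) ?card ?allotment_gt0 //=; last by rewrite dur run_time_gt0.
    rewrite /area card /= dur /run_time; congr (_ * _ `^ _).
    by rewrite mulrC divfK.
  have [n0|n0] := posnP n.
    by rewrite big1 => [|[i lt_in]]; [exact: ltW | exfalso; move: lt_in; rewrite n0].
  by rewrite optimal_area_energy // => j; exact: weight_gt0.
Qed.

(** The area of job i is prior for the n - rank - 1 jobs after it. With the factor 2 / m from the
    start times and 1 / m + 1 / delta from the run times, its coefficient is the weight. *)
Lemma scheduled_total s : scheduled n s ->
  total_completion (output_schedule I s) <= \sum_j w j * a j.
Proof.
case=> _ _ srv _ _; have {}srv j : served s j by apply: srv; exact: rank_lt.
have m0 : 0 < m%:R :> R by rewrite ltr0n; case: wfI.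
have sum_prior : \sum_j prior_area (rk j) = \sum_j (n - (rk j).+1)%:R * a j.
  rewrite /prior_area (exchange_big_dep xpredT) //=; apply: eq_bigr => i _.
  rewrite sumr_const mulr_natl; congr (_ *+ _).
  exact: (card_pos_geq _ (@pos_inj _ d)).
apply: (@le_trans _ _ (\sum_j (2 / m%:R * prior_area (rk j) +
    a j * (m%:R^-1 + (d j)%:R^-1)))).
  apply: ler_sum => j _; have [_ start_le dur _] := srv j.
  rewrite /completion /= dur lerD //.
    move: start_le; rewrite -ler_pdivlMl ?divr_gt0 // invf_div; exact.
  by rewrite ler_wpM2l ?invr_allotment_le // ltW ?a_gt0.
rewrite big_split /= -mulr_sumr sum_prior mulr_sumr -big_split /=.
rewrite le_eqVlt; apply/orP; left; apply/eqP; apply: eq_bigr => j _.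
rewrite /w /weight natrD natrM div1r /= -/(rk j); ring.
Qed.

Lemma scheduled_approximate s : scheduled n s ->
  approximate alpha 2 (output_schedule I s).
Proof.
move=> sch; have feas := scheduled_feasible sch; split=> //.
apply: le_trans (scheduled_total sch) _; rewrite -ler_pdivrMl //.
(* The computed schedule shows that the set is nonempty; half the weighted sum is a lower bound of
   it. *)
apply: lb_le_inf; first by
  exists (total_completion (output_schedule I s)); exists (output_schedule I s).
move=> _ [S feasS <-]; rewrite ler_pdivrMl //.
apply: optimal_area_le => //; first exact: pos_inj.
exact: pos_mono.
Qed.

End Correctness.

Lemma input_size_gt_njobs (R : realType) (I : instance R) :
  ((njobs I).+1 <= input_size I)%N.
Proof. exact: leq_addl. Qed.

Theorem theorem3 (R : realType) (alpha : R) (halpha : 1 < alpha) :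
  exists (p : cmd) (c d : nat),
    forall I : instance R, well_formed I -> equal_work I ->
    exists (t : nat) (s : state R),
      [/\ exec alpha p (input_state I) t s,
          (t <= c * input_size I ^ d)%N
        & approximate alpha 2 (output_schedule I s)].
Proof.
(* Both constants depend on the program text alone, so they serve every instance. *)
exists list_scheduling, (max_cost list_scheduling), (degree list_scheduling).
move=> I wfI [V V0 workV].
have [t [s [ex tT sch]]] := list_scheduling_spec halpha wfI V0 workV.
exists t, s; split=> //; last exact: scheduled_approximate sch.
apply: leq_trans tT _; rewrite leq_mul2l leq_exp2r //.
by rewrite input_size_gt_njobs orbT.
Qed.
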